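(* Let $D$ be a division ring algebraic over its center $F$ and let $G$ be an almost subnormal subgroup of $D^*$. If $G$ contains a non-abelian nilpotent-by-finite subgroup, then $G$ contains a non-cyclic free subgroup.
   Context: A group is nilpotent-by-finite if it has a nilpotent normal subgroup of finite index. A subgroup $H$ of a group $K$ is almost subnormal in $K$ if there is a chain of subgroups $H=H_r\le H_{r-1}\le\cdots\le H_1=K$ such that for each $1<i\le r$, either $H_i$ is normal in $H_{i-1}$ or $H_i$ has finite index in $H_{i-1}$. *)

(* Defs.v *)
From mathcomp Require Import all_boot all_algebra.
Set Implicit Arguments. Unset Strict Implicit. Unset Printing Implicit Defensive.
Import GRing.Theory.
Local Open Scope ring_scope.

Section Defs.
Variable D : unitRingType.

Definition subset_of := D -> Prop.

Definition is_division_ring : Prop := forall x : D, x != 0 -> x \is a GRing.unit.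

Definition central (x : D) : Prop := forall y : D, x * y = y * x.

Definition algebraic_over_center : Prop :=
  forall x : D, exists p : {poly D},
    p != 0 /\ (forall i, central p`_i) /\ p.[x] = 0.

Definition is_subgroup (H : subset_of) : Prop :=
  [/\ H 1,
      forall x, H x -> x \is a GRing.unit,
      forall x y, H x -> H y -> H (x * y)
    & forall x, H x -> H x^-1].

Definition sub (H K : subset_of) : Prop := forall x, H x -> K x.

Definition gen (S : subset_of) : subset_of :=
  fun x => forall K, is_subgroup K -> sub S K -> K x.

Definition normal_in (H K : subset_of) : Prop :=
  sub H K /\ forall x y, H x -> K y -> H (y^-1 * x * y).

Definition finite_index_in (H K : subset_of) : Prop :=
  sub H K /\ exists s : seq D, (forall z, z \in s -> K z) /\
    forall y, K y -> exists2 z, z \in s & H (z^-1 * y).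

Inductive almost_subnormal (K : subset_of) : subset_of -> Prop :=
| asn_refl : almost_subnormal K K
| asn_step (L H : subset_of) : almost_subnormal K L -> is_subgroup H ->
    (normal_in H L \/ finite_index_in H L) -> almost_subnormal K H.

Definition commg (x y : D) : D := x^-1 * y^-1 * x * y.

Fixpoint lcs (H : subset_of) (n : nat) : subset_of :=
  match n with
  | 0 => H
  | n.+1 => gen (fun z => exists x y, lcs H n x /\ H y /\ z = commg x y)
  end.

Definition nilpotent (H : subset_of) : Prop :=
  exists n, forall x, lcs H n x -> x = 1.

Definition abelian (H : subset_of) : Prop :=
  forall x y, H x -> H y -> x * y = y * x.

Definition nilpotent_by_finite (H : subset_of) : Prop :=
  exists N, is_subgroup N /\ normal_in N H /\ nilpotent N /\ finite_index_in N H.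

Definition eval_word (w : seq (D * bool)) : D :=
  foldr (fun l acc => (if l.2 then l.1 else l.1^-1) * acc) 1 w.

Fixpoint reduced_word (w : seq (D * bool)) : bool :=
  match w with
  | l1 :: ((l2 :: _) as w') =>
      ~~ ((l1.1 == l2.1) && (l1.2 != l2.2)) && reduced_word w'
  | _ => true
  end.

Definition free_basis (B H : subset_of) : Prop :=
  sub B H /\ (forall x, H x <-> gen B x) /\
  forall w : seq (D * bool), w != [::] -> reduced_word w ->
    (forall l, l \in w -> B l.1) -> eval_word w != 1.

Definition is_free (H : subset_of) : Prop := exists B, free_basis B H.

Definition cyclic (H : subset_of) : Prop :=
  exists x, forall y, H y <-> gen (fun z => z = x) y.

End Defs.

(* Main.v *)
From HB Require Import structures.
From mathcomp Require Import all_boot all_order all_algebra all_fingroup all_solvable all_field.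
From mathcomp Require Import ring zify.
Set Implicit Arguments. Unset Strict Implicit. Unset Printing Implicit Defensive.

(** Two elements [h] of [G] and [a] of [D] can be found that do not commute while
all conjugates of [a] by powers of [h] commute with each other: inside a nilpotent
subgroup one descends the lower central series, and over an abelian one of finite
index the only difficult case, that of a central subgroup, reduces to a counting
argument in a finite group. Since [a] is algebraic over the center it has finitely
many such conjugates, and after replacing [h] by a power we get a commutative
subfield [K] (a double centralizer) on which conjugation by [h] induces an
automorphism [sigma] of prime order [q], with [h^q] in [K]: a cyclic algebra, whose
elements act as matrices over [K] on the basis of powers of [h].

Not every valuation ring of [K] is [sigma]-stable: otherwise all the quotients
[(t - c) / (sigma t - c)], with [c] fixed by [sigma], would be integral, hence [K]
would be algebraic over its prime field. In characteristic zero this contradicts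
the existence of infinitely many primes dividing values of a given integer
polynomial, and in characteristic p it contradicts Wedderburn's little theorem.
By weak approximation some [g] of norm 1 in [K] then has conjugates with a strictly
largest and a strictly smallest absolute value. A power of [g] lies in [G] because
[1 - sigma] divides [q] on the norm 1 elements; conjugating it repeatedly produces
an element [x] of [G] in general position, and [g^N], [x g^N x^-1] play ping-pong for
large [N]. *)

(** * Self-commuting conjugates in finite groups *)

(** Since [D] is only algebraic over its center, it may have infinite dimension and need not embed
    in matrices over a field. Matrices are therefore attached only to elements built from [h] and
    [K], and membership in [G] is tracked only for powers and conjugates of such elements. Norm 1
    elements matter because commutators of [h] with elements of [K] have norm 1: this is how
    elements of [K] descend along the chain below [D^*], each step costing a fixed exponent.
    Self-commutation of the conjugates is essential, since a polynomial over the center can have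
    infinitely many roots in [D], but not in a commutative subfield. Primality of [q] makes every
    nontrivial power of [sigma] a generator, so a valuation ring that [sigma] does not preserve is
    preserved by none of these powers. Rank one is needed because powers of a small element must
    beat arbitrary constants; with that, ping-pong works with divisibility in a valuation ring,
    without completion or local compactness. *)

(* [c x y] stands for: the lifts of [x] and [y] to a central extension commute. *)
Section CommutationRelation.
Local Open Scope group_scope.
Variables (gT : finGroupType) (c : rel gT) (G0 : {group gT}).
Hypotheses (c_refl : {in G0, forall x, c x x}) (c1 : {in G0, forall x, c x 1})
  (c_sym : {in G0 &, forall x y, c x y -> c y x})
  (cM : {in G0 & &, forall x y z, c x y -> c x z -> c x (y * z)})
  (cJ : {in G0 & &, forall x y g, c x y -> c (x ^ g) (y ^ g)}).

(** In a minimal counterexample [c] is total on proper subgroups, so the centralizers [C x] of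
    elements outside the center [Z] are equal or meet in [Z]. If [g] normalizes [C x], then [x]
    commutes with all [x ^ (g ^+ i)], hence with [g]: thus [C x] is self-normalizing and [C x :\: Z]
    is a trivial intersection set. One conjugacy class of such sets is too small to cover [G :\: Z],
    and two are too large. *)
Lemma commutation_self_conjugates (G : {group gT}) : G \subset G0 ->
  (exists2 x, x \in G & exists2 y, y \in G & ~~ c x y) ->
  exists2 h, h \in G & exists2 x, x \in G & ~~ c x h /\ forall i, c x (x ^ (h ^+ i)).
Proof.
elim: {G}_.+1 {-2}G (ltnSn #|G|) => // m IHm G Gm GG0 [x0 Gx0 [y0 Gy0 nc0]].
have inG0 := subsetP GG0.
case: (altP (@existsP gT (fun h => (h \in G) && [exists x in G, ~~ c x h && [forall i : 'I_#[h], c x (x ^ (h ^+ i))]]))).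
  move=> [h /andP[Gh /existsP[x /and3P[Gx nxh /forallP xh]]]].
  exists h => //; exists x => //; split=> // i.
  by rewrite -(expg_mod_order h i); apply: (xh (Ordinal (ltn_pmod i (order_gt0 h)))).
move=> /existsPn no_pair.
have self_norm h x : h \in G -> x \in G -> (forall i, c x (x ^ (h ^+ i))) -> c x h.
  move=> Gh Gx xh; apply: contraLR isT => nxh; have := no_pair h; rewrite Gh /=.
  by case/negP; apply/existsP; exists x; rewrite Gx nxh; apply/forallP.
have total (M : {group gT}) : M \proper G -> {in M &, forall x y, c x y}.
  move=> MG x y Mx My; apply: contraLR isT => nxy; have MsG := proper_sub MG.
  have [||h Mh [z Mz [nzh zh]]] := IHm M _ (subset_trans MsG GG0).
  - exact: leq_trans (proper_card MG) Gm.
  - by exists x => //; exists y.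
  by case/negP: nzh; apply: self_norm => //; apply: (subsetP MsG).
pose C x := [set y in G | c x y].
have C_group x : x \in G -> group_set (C x).
  move=> Gx; apply/group_setP; split; first by rewrite inE group1 c1 ?inG0.
  by move=> y z /setIdP[Gy xy] /setIdP[Gz xz]; rewrite inE groupM // cM ?inG0.
pose Z := [set x in G | [forall y in G, c x y]].
have ZP x : reflect (x \in G /\ {in G, forall y, c x y}) (x \in Z).
  rewrite inE; apply: (iffP andP) => [[Gx /forall_inP]|[Gx xG]] //.
  by split=> //; apply/forall_inP.
have Z_group : group_set Z.
  apply/group_setP; split; first by apply/ZP; split=> // y Gy; rewrite c_sym ?c1 ?inG0.
  move=> x y /ZP[Gx cx] /ZP[Gy cy]; apply/ZP; split=> [|z Gz]; first exact: groupM.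
  by apply: c_sym; rewrite ?inG0 ?groupM //; apply: cM; rewrite ?inG0 //; apply: c_sym; rewrite ?inG0 ?cx ?cy.
have ZJ g x : g \in G -> x \in Z -> x ^ g \in Z.
  move=> Gg /ZP[Gx cx]; apply/ZP; split=> [|y Gy]; first exact: groupJ.
  by rewrite -(conjgKV g y) cJ ?inG0 ?cx ?groupJ ?groupV.
have CJ g x : g \in G -> x \in G -> C (x ^ g) = C x :^ g.
  move=> Gg Gx; apply/setP => y; rewrite mem_conjg !inE groupJr ?groupV //.
  case Gy: (y \in G) => //=; apply/idP/idP => h.
    by rewrite -[x](conjgK g) cJ ?inG0 ?groupJ ?groupV.
  by rewrite -(conjgKV g y) cJ ?inG0 ?groupJ ?groupV.
have subCG x : C x \subset G by apply/subsetP => y /setIdP[].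
have C_proper x : x \in G -> x \notin Z -> C x \proper G.
  move=> Gx; apply: contraR; rewrite properE subCG /= negbK => /subsetP GC.
  by apply/ZP; split=> // y /GC; rewrite inE => /andP[].
have C_total x : x \in G -> x \notin Z -> {in C x &, forall y z, c y z}.
  by move=> Gx xZ; apply: (total (Group (C_group x Gx))); apply: C_proper.
have Cxx x : x \in G -> x \in C x by move=> Gx; rewrite inE Gx c_refl ?inG0.
have C_eq x w : x \in G -> x \notin Z -> w \in C x -> w \notin Z -> C w = C x.
  move=> Gx xZ Cw wZ; have Gw : w \in G by case/setIdP: Cw.
  have CxCw : C x \subset C w.
    apply/subsetP => u Cu; rewrite inE; case/setIdP: (Cu) => -> _ /=.
    exact: C_total Gx xZ _ _ Cw Cu.
  apply/eqP; rewrite eqEsubset CxCw andbT; apply/subsetP => u Cu.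
  rewrite inE; case/setIdP: (Cu) => -> _ /=.
  by apply: (C_total _ Gw wZ) => //; apply: (subsetP CxCw); apply: Cxx.
pose A x := C x :\: Z.
have AJ g x : g \in G -> x \in G -> A x :^ g = A (x ^ g).
  move=> Gg Gx; rewrite /A CJ // conjDg; congr (_ :\: _).
  apply/eqP; rewrite eqEcard cardJg leqnn andbT; apply/subsetP => _ /imsetP[z Zz ->].
  exact: ZJ.
have TI x (Gx : x \in G) : x \notin Z -> normedTI (A x) G (Group (C_group x Gx)).
  move=> xZ; apply/normedTI_P; split.
  - by apply/set0Pn; exists x; rewrite inE xZ Cxx.
  - apply/subsetP => g Cg; have Gg : g \in G by apply: (subsetP (subCG x)).
    rewrite inE Gg /=; apply/normP; rewrite AJ //; rewrite /A CJ //.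
    by rewrite (conjGid (Cg : g \in Group (C_group x Gx))).
  move=> g Gg; rewrite AJ // => /pred0Pn[w /andP[/= /setDP[Cw wZ] /setDP[Cw' _]]].
  have xgZ : x ^ g \notin Z.
    by apply: contra xZ => /(ZJ g^-1); rewrite groupV conjgK; apply.
  have CE : C x :^ g = C x by rewrite -CJ // -(C_eq _ _ _ xgZ Cw' wZ) ?groupJ // (C_eq _ _ Gx xZ Cw wZ).
  rewrite inE Gg self_norm // => i.
  have : x ^ (g ^+ i) \in C x; last by case/setIdP.
  have gN : C x :^ (g ^+ i) = C x.
    apply/normP; apply: groupX; apply/normP; exact: CE.
  by rewrite -gN memJ_conjg; apply: Cxx.
have cardZ_gt0 : (0 < #|Z|)%N by rewrite (cardG_gt0 (Group Z_group)).
have subZC x : x \in G -> Z \subset C x.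
  by move=> Gx; apply/subsetP => z /ZP[Gz cz]; rewrite inE Gz c_sym ?inG0 ?cz.
have card_A x : x \in G -> x \notin Z ->
  [/\ (#|class_support (A x) G| = (#|C x| - #|Z|) * #|G : C x|)%N,
      (2 * #|Z| <= #|C x|)%N & (#|C x| * #|G : C x| = #|G|)%N].
  move=> Gx xZ; split.
  - by rewrite (card_support_normedTI (TI x Gx xZ)) cardsD (setIidPr (subZC x Gx)).
  - have /dvdnP[k kE] : #|Z| %| #|C x| by apply: (cardSg (H := Group Z_group) (G := Group (C_group x Gx))); apply: subZC.
    have : (#|Z| < #|C x|)%N.
      by apply: proper_card; rewrite properE subZC //; apply/subsetPn; exists x => //; apply: Cxx.
    by rewrite kE; case: (k) => [|[|l]]; rewrite ?mul0n ?mul1n ?ltnn // => _; rewrite leq_mul2r orbT.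
  exact: (Lagrange (subCG x : Group (C_group x Gx) \subset G)).
have supp x : x \in G -> class_support (A x) G \subset G :\: Z.
  move=> Gx; apply/subsetP => _ /imset2P[w g /setDP[Cw wZ] Gg ->].
  have Gw := subsetP (subCG x) _ Cw; rewrite inE groupJ // andbT.
  by apply: contra wZ => /(ZJ g^-1); rewrite groupV conjgK; apply.
have nZx0 : x0 \notin Z by apply: contra nc0 => /ZP[_]; apply.
have cardGZ : #|G :\: Z| = (#|G| - #|Z|)%N.
  by rewrite cardsD (setIidPr _) //; by apply/subsetP => x /ZP[].
have [cA cZ cG] := card_A x0 Gx0 nZx0.
have [GU|] := boolP (G :\: Z \subset class_support (A x0) G).
  have e : class_support (A x0) G = G :\: Z by apply/eqP; rewrite eqEsubset GU supp.
  (* The class of [A x0] has [|G| - |Z| * |G : C x0|] elements, fewer than [|G| - |Z|]. *)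
  have I1 : (1 < #|G : C x0|)%N.
    rewrite (@indexg_gt1 _ G (Group (C_group x0 Gx0))); have := C_proper _ Gx0 nZx0.
    by rewrite properE => /andP[].
  have : (#|Z| <= #|C x0|)%N by apply: subset_leq_card; apply: subZC.
  by move: cA; rewrite e cardGZ -cG; nia.
move=> /subsetPn[x1 /setDP[Gx1 nZx1] x1U].
have [cA1 cZ1 cG1] := card_A x1 Gx1 nZx1.
have dis : [disjoint class_support (A x0) G & class_support (A x1) G].
  apply/pred0P => w; apply/negP => /andP[/= /imset2P[u g /setDP[Cu uZ] Gg ->]].
  move=> /imset2P[v g' /setDP[Cv vZ] Gg' uv]; case/negP: x1U.
  have Gu := subsetP (subCG x0) _ Cu; have Gv := subsetP (subCG x1) _ Cv.
  apply/imset2P; exists (x1 ^ (g' * g^-1)) (g * g'^-1); last 1 first.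
  - by rewrite -conjgM mulgA mulgKV mulgV conjg1.
  - rewrite inE; apply/andP; split.
      by apply: contra nZx1 => /(ZJ (g' * g^-1)^-1); rewrite groupV groupM ?groupV // conjgK; apply.
    rewrite -(C_eq _ _ Gx0 nZx0 Cu uZ) -[u](conjgK g) uv -conjgM CJ ?groupM ?groupV //.
    by rewrite memJ_conjg (C_eq _ _ Gx1 nZx1 Cv vZ); apply: Cxx.
  - by rewrite groupM ?groupV.
have cardU : #|class_support (A x0) G :|: class_support (A x1) G| =
    (#|class_support (A x0) G| + #|class_support (A x1) G|)%N.
  by apply/eqP; rewrite (leq_card_setU _ _).
have : (#|class_support (A x0) G :|: class_support (A x1) G| <= #|G :\: Z|)%N.
  by apply: subset_leq_card; rewrite subUset !supp.
(* Each of the two disjoint classes has at least half of [|G|] elements, because [Z] has index at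
   least 2 in each centralizer. *)
have half a z i : (2 * z <= a)%N -> (a * i <= 2 * ((a - z) * i))%N.
  by move=> za; rewrite mulnA leq_mul2r; apply/orP; right; lia.
have := half _ _ #|G : C x0| cZ; have := half _ _ #|G : C x1| cZ1.
rewrite cardU cardGZ cG cG1 -cA -cA1; have := cardG_gt0 G; lia.
Qed.
End CommutationRelation.

From mathcomp Require Import boolp classical_sets.
Require Import Defs.
Import GRing.Theory.
Local Open Scope ring_scope.

(** * Division subrings *)

Section SubDivisionRing.
Variables (D : unitRingType) (P : D -> Prop).
Definition divring_subset : Prop :=
  [/\ P 1, forall x y, P x -> P y -> P (x - y) & forall x y, P x -> P y -> P (x / y)].
Hypothesis Pdiv : divring_subset.

(** The closure proof is an argument so that the structures on [sub_type] can be inferred from the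
    predicate itself. *)
Definition sub_pred of divring_subset : pred D := fun x => `[< P x >].

Lemma sub_pred_closed : divring_closed (sub_pred Pdiv).
Proof.
case: (Pdiv) => P1 PB Pd; split; first exact/asboolP.
- by move=> x y /asboolP Px /asboolP Py; apply/asboolP/PB.
- by move=> x y /asboolP Px /asboolP Py; apply/asboolP/Pd.
Qed.

HB.instance Definition _ :=
  GRing.isDivringClosed.Build D (sub_pred Pdiv) sub_pred_closed.

Record sub_type : Type := SubType { sub_val :> D; _ : sub_val \in sub_pred Pdiv }.
HB.instance Definition _ := [isSub for sub_val].
HB.instance Definition _ := [Choice of sub_type by <:].
HB.instance Definition _ := [SubChoice_isSubUnitRing of sub_type by <:].
End SubDivisionRing.

Lemma subfield_type (D : unitRingType) (P : D -> Prop) :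
  is_division_ring D -> divring_subset P -> abelian P ->
  exists (K : fieldType) (iota : {rmorphism K -> D}),
    forall x, P x <-> exists k, iota k = x.
Proof.
move=> divD Pdiv Pcomm; pose T := sub_type Pdiv.
have TP (x : T) : P (val x) by exact/asboolP/(valP x).
have mulC : commutative (@GRing.mul T).
  by move=> x y; apply: val_inj; exact: (Pcomm _ _ (TP x) (TP y)).
have fT : GRing.field_axiom T.
  move=> x x0; have ux : val x \is a GRing.unit.
    by apply: divD; apply: contraNneq x0 => x0; apply/eqP/val_inj.
  have Px : (val x)^-1 \in sub_pred Pdiv.
    have [P1 _ Pd] := Pdiv; apply/asboolP; rewrite -div1r; exact: (Pd _ _ P1 (TP x)).
  by apply/unitrP; exists (SubType Px); split; apply: val_inj; rewrite rmorphM /= ?mulVr ?mulrV.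
pose T1 : comUnitRingType :=
  HB.pack T (GRing.PzRing_hasCommutativeMul.Build T mulC).
pose K : fieldType := HB.pack (GRing.ComUnitRing.sort T1) (GRing.ComUnitRing_isField.Build T1 fT).
exists K, (GRing.RMorphism.clone _ _ (val : T -> D) _ : {rmorphism T -> D}) => x.
split=> [Px | [k <-]]; last exact: TP.
have Px' : x \in sub_pred Pdiv by apply/asboolP.
by exists (SubType Px').
Qed.

(** The list [s] makes the subring a finite domain, to which Wedderburn's little theorem applies. *)
Lemma finite_divring_subset_abelian (D : unitRingType) (P : D -> Prop) (s : seq D) :
  is_division_ring D -> divring_subset P -> (forall x, P x -> x \in s) -> abelian P.
Proof.
move=> divD Pdiv Ps; pose T := sub_type Pdiv.
have TP (x : T) : P (val x) by exact/asboolP/(valP x).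
have Hs (x : T) : (index (val x) s < size s)%N by rewrite index_mem; exact: (Ps _ (TP x)).
pose f x := Ordinal (Hs x); pose g (i : 'I_(size s)) : option T := insub s`_i.
have fgK : pcancel f g by move=> x; rewrite /g /= nth_index ?valK //; exact: (Ps _ (TP x)).
pose C : countType := HB.pack T (@PCanIsCountable _ _ f g fgK).
pose F : finUnitRingType := HB.pack T C (@PCanIsFinite C _ f g fgK).
have domF : GRing.integral_domain_axiom F.
  move=> x y xy0; apply/orP.
  have {}xy0 : val (x : T) * val (y : T) = 0 by have := congr1 (val : T -> D) xy0.
  have [x0|x0] := eqVneq (val (x : T)) 0; first by left; apply/eqP/val_inj.
  right; apply/eqP/(val_inj : injective (val : T -> D)).
  by apply: (mulrI (divD _ x0)); rewrite /= mulr0.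
move=> x y Px Py.
have Px' : x \in sub_pred Pdiv by apply/asboolP.
have Py' : y \in sub_pred Pdiv by apply/asboolP.
have := @finDomain_mulrC F domF (SubType Px') (SubType Py').
by move/(congr1 val).
Qed.

(** * Valuation rings *)

Section ValuationRings.
Local Open Scope classical_set_scope.
Local Open Scope ring_scope.
Variable K : fieldType.
Implicit Types (O M : set K) (p : {poly K}) (x y : K).

Definition is_subring O : Prop :=
  [/\ O 1, forall x y, O x -> O y -> O (x - y) & forall x y, O x -> O y -> O (x * y)].

Definition coefs_in O p : Prop := forall i, O p`_i.

Definition val_ring O : Prop := is_subring O /\ forall x, O x \/ O x^-1.

(* [0] is listed separately because [0^-1 = 0] lies in every subring. *)
Definition max_ideal O x : Prop := x = 0 \/ ~ O x^-1.

(** The archimedean property, stated without a value group. The whole field also qualifies, so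
    nontriviality is always carried by a nonzero element of [max_ideal O]. *)
Definition rank_one O : Prop :=
  val_ring O /\ forall y, max_ideal O y -> forall x, exists n, O (y ^+ n * x).

Section Subring.
Variable O : set K.
Hypothesis Oring : is_subring O.

Lemma subring1 : O 1. Proof. by case: Oring. Qed.
Lemma subringB x y : O x -> O y -> O (x - y). Proof. by case: Oring => _ h _; apply: h. Qed.
Lemma subringM x y : O x -> O y -> O (x * y). Proof. by case: Oring => _ _ h; apply: h. Qed.
Lemma subring0 : O 0. Proof. by rewrite -(subrr 1); apply: subringB; apply: subring1. Qed.
Lemma subringN x : O x -> O (- x).
Proof. by move=> Ox; rewrite -sub0r; apply: subringB => //; apply: subring0. Qed.
Lemma subringD x y : O x -> O y -> O (x + y).
Proof. by move=> Ox Oy; rewrite -[y]opprK; apply/subringB/subringN. Qed.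
Lemma subringX x n : O x -> O (x ^+ n).
Proof.
by move=> Ox; elim: n => [|n IHn]; rewrite ?expr0 ?exprS; [apply: subring1 | apply: subringM].
Qed.
Lemma subring_sum (I : Type) (r : seq I) (P : pred I) (F : I -> K) :
  (forall i, P i -> O (F i)) -> O (\sum_(i <- r | P i) F i).
Proof. by apply: big_ind; [apply: subring0 | apply: subringD]. Qed.
Lemma subring_int (n : int) : O n%:~R.
Proof.
have On (m : nat) : O m%:R.
  by elim: m => [|m IHm]; rewrite ?mulrS; [apply: subring0 | apply/subringD/IHm/subring1].
by case: n => n; rewrite ?NegzE ?mulrNz; [apply: On | apply/subringN/On].
Qed.
Lemma subring_horner p x : coefs_in O p -> O x -> O p.[x].
Proof.
move=> Op Ox; rewrite horner_coef; apply: subring_sum => i _.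
by apply: subringM; [apply: Op | apply: subringX].
Qed.

Lemma coefs_inC x : O x -> coefs_in O x%:P.
Proof. by move=> Ox i; rewrite coefC; case: eqP => // _; apply: subring0. Qed.
Lemma coefs_inX : coefs_in O 'X.
Proof. by move=> i; rewrite coefX; case: eqP => _; [apply: subring1 | apply: subring0]. Qed.
Lemma coefs_inB p q : coefs_in O p -> coefs_in O q -> coefs_in O (p - q).
Proof. by move=> Op Oq i; rewrite coefB; apply: subringB. Qed.
Lemma coefs_inM p q : coefs_in O p -> coefs_in O q -> coefs_in O (p * q).
Proof. by move=> Op Oq i; rewrite coefM; apply: subring_sum => j _; apply: subringM. Qed.

Lemma subring_exp_horner_inv y p : coefs_in O p -> O y -> O (y ^+ size p * p.[y^-1]).
Proof.
move=> Op Oy; have [->|y0] := eqVneq y 0.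
  by rewrite invr0; apply: subringM; [apply/subringX/subring0 | apply/subring_horner/subring0].
rewrite horner_coef mulr_sumr; apply: subring_sum => i _.
rewrite mulrCA exprVn -expfB_cond ?(negPf y0) ?add0n; last exact: ltnW.
by apply: subringM => //; apply: subringX.
Qed.
End Subring.

Definition adjoin O x : set K := fun z => exists2 p, coefs_in O p & z = p.[x].

Lemma adjoin_subring O x : is_subring O -> is_subring (adjoin O x).
Proof.
move=> Or; split.
- by exists 1%:P; [apply: coefs_inC (subring1 Or) | rewrite hornerC].
- by move=> _ _ [p Op ->] [q Oq ->]; exists (p - q); [apply: coefs_inB | rewrite !hornerE].
- by move=> _ _ [p Op ->] [q Oq ->]; exists (p * q); [apply: coefs_inM | rewrite hornerM].
Qed.

Lemma sub_adjoin O x : is_subring O -> (O `<=` adjoin O x).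
Proof. by move=> Or y Oy; exists y%:P; [apply: coefs_inC | rewrite hornerC]. Qed.

Lemma mem_adjoin O x : is_subring O -> adjoin O x x.
Proof. by move=> Or; exists 'X; [apply: coefs_inX | rewrite hornerX]. Qed.

Lemma Zorn_subring (Q : set (set K)) O : is_subring O -> Q O ->
  (forall F : set (set K), F !=set0 -> total_on F subset -> (F `<=` Q) ->
     Q (\bigcup_(X in F) X)) ->
  exists M, [/\ is_subring M, (O `<=` M), Q M &
    forall M', is_subring M' -> (M `<=` M') -> Q M' -> (M' `<=` M)].
Proof.
move=> Or QO QU.
pose P : set (set K) := fun X => X = set0 \/ [/\ is_subring X, (O `<=` X) & Q X].
have [F PF totF|M [PM maxM]] := @Zorn_bigcup K P.
  have [[X FX /set0P X0]|F0] := pselect (exists2 X, F X & X != set0).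
    have PF' Y : F Y -> Y !=set0 -> [/\ is_subring Y, (O `<=` Y) & Q Y].
      by move=> FY /set0P Y0; case: (PF _ FY) => // Y00; rewrite Y00 eqxx in Y0.
    have [Xr OX QX] := PF' X FX X0.
    pose F' := [set Y | F Y /\ Y !=set0].
    have -> : (\bigcup_(X in F) X) = (\bigcup_(X in F') X).
      apply/seteqP; split=> z [Y FY Yz]; exists Y => //; last by case: FY.
      by split=> //; exists z.
    have F'r Y : F' Y -> is_subring Y by case=> FY /(PF' _ FY) [].
    have common Y Z a b : F' Y -> F' Z -> Y a -> Z b -> exists2 W, F' W & W a /\ W b.
      move=> FY FZ Ya Zb; case: FY (FY) => FY1 _ FY; case: FZ (FZ) => FZ1 _ FZ.
      by case: (totF _ _ FY1 FZ1) => [/(_ _ Ya)|/(_ _ Zb)] ?; [exists Z | exists Y].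
    right; split.
    - split; first by exists X => //; apply: subring1.
        move=> a b [Y FY Ya] [Z FZ Zb]; have [W FW [Wa Wb]] := common _ _ _ _ FY FZ Ya Zb.
        by exists W => //; apply: subringB => //; apply: F'r.
      move=> a b [Y FY Ya] [Z FZ Zb]; have [W FW [Wa Wb]] := common _ _ _ _ FY FZ Ya Zb.
      by exists W => //; apply: subringM => //; apply: F'r.
    - by move=> z Oz; exists X => //; apply: OX.
    - apply: QU; first by exists X.
        by move=> Y Z [FY _] [FZ _]; apply: totF.
      by move=> Y [FY /(PF' _ FY) []].
  left; apply/seteqP; split=> // x [X FX Xx]; apply: F0.
  by exists X => //; apply/set0P; exists x.
have {PM} [M0|[Mr OM QM]] := PM.
  case: (maxM O); last by right; split.
  by rewrite M0; split=> // /(_ _ (subring1 Or)).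
exists M; split=> // M' M'r MM' QM' x M'x; apply: contrapT => Mx.
apply: (maxM M'); last by right; split=> // z /OM; apply: MM'.
by split=> // /(_ _ M'x).
Qed.

(* A subring [V] maximal for avoiding [x^-1] is a valuation ring: [1 + x V] consists
of units of [V], which is what the degree descent of Chevalley's theorem needs. *)
Lemma ex_max_avoiding O x : is_subring O -> O x -> ~ O x^-1 ->
  exists V, [/\ val_ring V, O `<=` V, ~ V x^-1 &
    forall y, max_ideal V y -> exists k, V (y ^+ k / x)].
Proof.
move=> Or Ox nOx.
have [|V [Vr OV nVx maxV]] := @Zorn_subring (fun X => ~ X x^-1) O Or nOx.
  by move=> F _ _ FQ [X /FQ].
have adjV y : ~ V y -> exists2 p, coefs_in V p & x^-1 = p.[y].
  move=> nVy; apply: contrapT => nx; apply: nVy.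
  apply: (maxV (adjoin V y)); rewrite /adjoin.
  - exact: adjoin_subring.
  - exact: sub_adjoin.
  - by [].
  - exact: mem_adjoin.
have Vx : V x by apply: OV.
have x0 : x != 0 by apply: contra_not_neq nVx => ->; rewrite invr0; apply: subring0.
(* Otherwise [x^-1] is a polynomial in [u^-1], and multiplying by [u ^+ size p], which is [1] modulo
   [x], puts [x^-1] itself in [V]. *)
have unit1 e : V e -> V (1 + x * e)^-1.
  move=> Ve; set u := 1 + x * e; apply: contrapT => nVu.
  have [p Vp xp] := adjV _ nVu; apply: nVx.
  have Vu : V u by apply: (subringD Vr (subring1 Vr)); apply: subringM.
  have [e' Ve' ue'] : exists2 e', V e' & u ^+ size p = 1 + x * e'.
    elim: (size p) => [|n [e' Ve' IHn]]; first by exists 0; [apply: subring0 | rewrite mulr0 addr0].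
    exists (e + u * e'); first by apply: subringD => //; apply: subringM.
    by rewrite exprS IHn mulrDr mulr1 /u -addrA mulrDr (mulrCA x).
  have := subring_exp_horner_inv Vr Vp Vu.
  rewrite -xp ue' mulrDl mul1r mulrAC mulfV // mul1r => Vxe.
  by rewrite -(addrK e' x^-1); apply: subringB.
have Vval y : V y \/ V y^-1.
  apply: contrapT => /not_orP[].
  pose E z n := exists2 p, coefs_in V p & (size p <= n)%N /\ x * p.[z] = 1.
  have exE z : ~ V z -> exists n, `[< E z n >].
    move=> /adjV[p Vp xp]; exists (size p); apply/asboolP; exists p => //.
    by rewrite -xp mulfV.
  have descent z n m : E z n -> E z^-1 m -> (m <= n)%N -> exists2 n', (n' < n)%N & E z n'.
    move=> [p Vp [pn p1]] [q Vq [qm q1]] mn.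
    case: n => [|n] in pn mn *.
      by move: pn; rewrite leqn0 size_poly_eq0 => /eqP p0; move: p1;
         rewrite p0 horner0 mulr0 => /esym/eqP; rewrite oner_eq0.
    exists n => //.
    have z0 : z != 0.
      apply/eqP => z0; apply: nVx; have -> : x^-1 = p.[z] by apply: (mulfI x0); rewrite mulfV.
      by apply: subring_horner => //; rewrite z0; apply: subring0.
    pose e := (1 - x * q`_0)^-1.
    have Ve : V e.
      rewrite /e -mulrN; apply: unit1; by apply: subringN => //; apply: Vq.
    have e0 : 1 - x * q`_0 != 0.
      apply/eqP => h; apply: nVx; have -> : x^-1 = q`_0.
        by apply: (mulfI x0); rewrite mulfV //; apply/eqP; rewrite -subr_eq0 h.
      exact: Vq.
    (* Multiplying [1 = x * q.[z^-1]] by [z ^+ n] and dividing by the unit [1 - x * q_0] gives [z ^+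
       n = x * g.[z]], which eliminates the top term of [p]. *)
    pose g := \poly_(i < n) (e * q`_(n - i)).
    have gz : x * g.[z] = z ^+ n.
      move: q1; rewrite (@horner_coef_wide _ n.+1) ?(leq_trans qm) // big_ord_recl /= expr0 mulr1.
      set S := \sum_(i < n) _; rewrite mulrDr => q1.
      have eS : 1 - x * q`_0 = x * S by rewrite -q1 addrAC subrr add0r.
      have -> : g.[z] = e * (z ^+ n * S).
        rewrite horner_poly !mulr_sumr (reindex_inj rev_ord_inj) /=; apply: eq_bigr => i _.
        have -> : (n - (n - i.+1))%N = i.+1 by rewrite subKn.
        rewrite -mulrA; congr (_ * _); rewrite mulrCA; congr (_ * _).
        by rewrite exprVn -expfB_cond ?(negPf z0) ?add0n.
      by rewrite /e eS mulrCA (mulrCA x) mulrCA mulVf ?mulr1 // -eS.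
    pose c := p`_n.
    have Vg : coefs_in V g.
      move=> i; rewrite coef_poly; case: ifP => _; last exact: subring0.
      by apply: subringM => //; apply: Vq.
    exists (p - c *: 'X^n + (c * x) *: g).
      move=> i; rewrite !(coefD, coefN, coefZ, coefXn); apply: subringD => //; last first.
        by apply: subringM; [|apply: subringM => //; apply: Vp|apply: Vg].
      apply: subringB => //.
      by case: eqP => _; rewrite ?mulr1 ?mulr0; [apply: Vp | apply: subring0].
    split.
      apply/leq_sizeP => i; rewrite leq_eqVlt => /predU1P[<-|ni].
        by rewrite !(coefD, coefN, coefZ, coefXn) eqxx mulr1 subrr coef_poly ltnn mulr0 addr0.
      rewrite !(coefD, coefN, coefZ, coefXn) coef_poly gtn_eqF // mulr0 subr0 ltnNge (ltnW ni) mulr0.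
      by rewrite addr0 nth_default // (leq_trans pn).
    by rewrite !hornerE -mulrA gz subrK.
  move=> nVy nVyV; have := exE _ nVy; have := exE _ nVyV => exV ex0.
  case: (ex_minnP ex0) => n /asboolP En minn; case: (ex_minnP exV) => m /asboolP Em minm.
  case: (leqP m n) => [mn|/ltnW nm].
    by have [k + /asboolP/minn] := descent _ _ _ En Em mn; rewrite ltnNge => /negP.
  rewrite -[y]invrK in En.
  by have [k + /asboolP/minm] := descent _ _ _ Em En nm; rewrite ltnNge => /negP.
have nVV y : ~ V y^-1 -> V y by case: (Vval y).
exists V; split=> // y [->|nVy].
  by exists 1%N; rewrite expr1 mul0r; apply: subring0.
have [p Vp xp] := adjV _ nVy; exists (size p); rewrite xp.
exact: subring_exp_horner_inv (nVV _ nVy).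
Qed.
End ValuationRings.

(** * The maximal ideal of a valuation ring, and integral closedness *)

Section ValuationRingTheory.
Variables (K : fieldType) (O : set K).
Hypothesis Oval : val_ring O.
Let Oring : is_subring O := proj1 Oval.
Local Notation m := (max_ideal O).

Lemma max_ideal_sub x : m x -> O x.
Proof. by case=> [->|]; [apply: subring0 | case: (proj2 Oval x)]. Qed.

Lemma max_ideal0 : m 0. Proof. by left. Qed.

Lemma max_ideal_inv x : ~ O x -> m x^-1.
Proof. by right; rewrite invrK. Qed.

Lemma not_max_ideal_inv x : x != 0 -> m x -> ~ O x^-1.
Proof. by move=> /eqP x0 []. Qed.

Lemma unit_inv x : ~ m x -> x != 0 /\ O x^-1.
Proof.
move=> nmx; split; first by apply/eqP => x0; apply: nmx; left.
by apply: contrapT => nOx; apply: nmx; right.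
Qed.

Lemma not_max_ideal1 : ~ m 1.
Proof. by case=> [/eqP|]; rewrite ?oner_eq0 // invr1 => /(_ (subring1 Oring)). Qed.

Lemma max_idealM x y : m x -> O y -> m (x * y).
Proof.
move=> mx Oy; have [->|x0] := eqVneq x 0; first by left; rewrite mul0r.
have [->|y0] := eqVneq y 0; first by left; rewrite mulr0.
right=> Oxy; apply: (not_max_ideal_inv x0 mx).
have -> : x^-1 = y * (x * y)^-1 by rewrite invfM mulrCA mulfV ?mulr1.
exact: subringM.
Qed.

Lemma max_idealN x : m x -> m (- x).
Proof. by move=> mx; rewrite -mulrN1; apply: max_idealM => //; apply: subringN => //; apply: subring1. Qed.

Lemma max_idealD x y : m x -> m y -> m (x + y).
Proof.
have [->|x0] := eqVneq x 0; first by rewrite add0r.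
have [->|y0] := eqVneq y 0; first by rewrite addr0.
move=> mx my; have [Oxy|Oyx] := proj2 Oval (x / y).
  have -> : x + y = y * (1 + x / y) by rewrite mulrDr mulr1 mulrCA mulfV // mulr1 addrC.
  by apply: max_idealM => //; apply: subringD => //; apply: subring1.
have -> : x + y = x * (1 + (x / y)^-1).
  by rewrite mulrDr mulr1 invf_div mulrCA mulfV // mulr1.
by apply: max_idealM => //; apply: subringD => //; apply: subring1.
Qed.

Lemma max_ideal_sum (I : Type) (r : seq I) (P : pred I) (F : I -> K) :
  (forall i, P i -> m (F i)) -> m (\sum_(i <- r | P i) F i).
Proof. by apply: big_ind; [apply: max_ideal0 | apply: max_idealD]. Qed.

Lemma max_ideal_unit1 x : m x -> 1 + x != 0 /\ O (1 + x)^-1.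
Proof.
move=> mx; apply: unit_inv => mx1; apply: not_max_ideal1.
by rewrite -(addrK x 1); apply: max_idealD => //; apply: max_idealN.
Qed.

Lemma max_idealX x n : m x -> m (x ^+ n.+1).
Proof. by move=> mx; rewrite exprS; apply: max_idealM => //; apply: subringX => //; apply: max_ideal_sub. Qed.

Lemma val_ring_integral x p : coefs_in O p -> p \is monic -> root p x -> O x.
Proof.
move=> Op mon_p /rootP px; have [//|Ox'] := proj2 Oval x.
have [->|x0] := eqVneq x 0; first exact: subring0.
have [n sp] : exists n, size p = n.+2.
  have := root_size_gt1 (monic_neq0 mon_p) (introT rootP px).
  by case: (size p) => [|[|n]] // _; exists n.
move: px; rewrite horner_coef sp big_ord_recr /=.
have -> : p`_n.+1 = 1 by move/monicP: mon_p; rewrite lead_coefE sp.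
rewrite mul1r => /eqP; rewrite addrC addr_eq0 => /eqP px.
have -> : x = x ^+ n.+1 / x ^+ n by rewrite exprS mulfK // expf_neq0.
rewrite px mulNr; apply: subringN => //; rewrite mulr_suml; apply: subring_sum => // i _.
rewrite -mulrA; apply: subringM => //.
have -> : x ^+ i / x ^+ n = x^-1 ^+ (n - i).
  by rewrite exprVn expfB_cond ?(negPf x0) ?add0n -1?ltnS // invf_div.
exact: subringX.
Qed.

End ValuationRingTheory.

(** * Elements algebraic over the prime field *)

Section AlgebraicElements.
Variable K : fieldType.
Implicit Types (x y : K) (d : int).

Local Notation int_integral := (integralOver (intr : int -> K)).

(* Algebraicity over the prime field, uniformly in the characteristic. *)
Definition int_algebraic x : Prop := exists2 d, d%:~R != 0 :> K & int_integral (d%:~R * x).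

(** For nonconstant [p] with leading coefficient [c] and degree [n] this is [c^(n-1) * p(X / c)],
    written without division. *)
Definition monicize (p : {poly K}) : {poly K} :=
  let n := (size p).-1 in
  'X^n + \poly_(i < n) (p`_i * lead_coef p ^+ (n.-1 - i)).

Lemma monicize_monic p : monicize p \is monic.
Proof.
rewrite monicE lead_coefDl ?lead_coefXn // size_polyXn ltnS; exact: size_poly.
Qed.

Lemma monicize_root p x : p != 0 -> root p x -> root (monicize p) (lead_coef p * x).
Proof.
move=> p0 px; have := root_size_gt1 p0 px.
rewrite /monicize; case sp: (size p) => [|[|n]] // _ /=; apply/rootP.
rewrite !hornerE horner_poly exprMn exprS -mulrA.
move/rootP: px; rewrite horner_coef sp big_ord_recr /= => px.
have -> : \sum_(i < n.+1) p`_i * lead_coef p ^+ (n - i) * (lead_coef p * x) ^+ i =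
          lead_coef p ^+ n * \sum_(i < n.+1) p`_i * x ^+ i.
  rewrite mulr_sumr; apply: eq_bigr => i _.
  have -> : lead_coef p ^+ n = lead_coef p ^+ (n - i) * lead_coef p ^+ i.
    by rewrite -exprD subnK // -ltnS.
  by rewrite exprMn; ring.
have lp : lead_coef p = p`_n.+1 by rewrite lead_coefE sp.
by rewrite mulrCA -mulrDr addrC lp px mulr0.
Qed.

Lemma root_int_algebraic (p : {poly int}) x :
  map_poly intr p != 0 :> {poly K} -> root (map_poly intr p) x -> int_algebraic x.
Proof.
set P := map_poly intr p => P0 Px.
have lP : lead_coef P = (p`_(size P).-1)%:~R by rewrite lead_coefE coef_map.
(* The coefficient is taken at the degree of the image [P], since the leading coefficient of [p] may
   vanish in [K]. *)
exists p`_(size P).-1; rewrite -lP ?lead_coef_eq0 //.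
pose n := (size P).-1; pose c := p`_n.
exists ('X^n + \poly_(i < n) (p`_i * c ^+ (n.-1 - i))).
  by rewrite monicE lead_coefDl ?lead_coefXn // size_polyXn ltnS; apply: size_poly.
have -> : map_poly intr ('X^n + \poly_(i < n) (p`_i * c ^+ (n.-1 - i))) = monicize P.
  rewrite rmorphD /= map_polyXn; congr (_ + _); apply/polyP => i.
  rewrite coef_map 2!coef_poly [P`_i]coef_map -/n; case: ifP => _; last by [].
  by rewrite /= intrM rmorphXn lP.
exact: monicize_root.
Qed.

Lemma integral_int_algebraic x : int_integral x -> int_algebraic x.
Proof. by move=> xi; exists 1; rewrite ?mul1r ?oner_eq0. Qed.

Lemma int_algebraic1 : int_algebraic 1.
Proof. exact/integral_int_algebraic/integral1. Qed.

Lemma int_algebraicB x y : int_algebraic x -> int_algebraic y -> int_algebraic (x - y).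
Proof.
move=> [d d0 dx] [e e0 ey]; exists (d * e); rewrite intrM; first exact: mulf_neq0.
have -> : d%:~R * e%:~R * (x - y) = e%:~R * (d%:~R * x) - d%:~R * (e%:~R * y) :> K by ring.
by apply: integral_sub; apply: integral_mul => //; exact: (@integral_id _ _ (intr : {rmorphism int -> K})). 
Qed.

Lemma int_algebraicM x y : int_algebraic x -> int_algebraic y -> int_algebraic (x * y).
Proof.
move=> [d d0 dx] [e e0 ey]; exists (d * e); rewrite intrM; first exact: mulf_neq0.
by rewrite mulrACA; apply: integral_mul.
Qed.

Lemma int_algebraicV x : int_algebraic x -> int_algebraic x^-1.
Proof.
have [->|x0] := eqVneq x 0; first by rewrite invr0.
move=> [d d0 [p mon_p /rootP pdx]]; set y := d%:~R * x in pdx.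
have y0 : y != 0 by rewrite mulf_neq0.
have -> : x^-1 = d%:~R * y^-1 by rewrite invfM mulrA mulfV // mul1r.
apply: int_algebraicM; first by apply: integral_int_algebraic; exact: (@integral_id _ _ (intr : {rmorphism int -> K})).
(* The reciprocal polynomial; its constant term is the leading coefficient 1 of [p], so its image in
   [K] is nonzero. *)
pose q : {poly int} := \poly_(i < size p) p`_((size p).-1 - i).
have qi i : (map_poly intr q)`_i = if (i < size p)%N then (p`_((size p).-1 - i))%:~R else 0 :> K.
  by rewrite coef_map coef_poly /=; case: ifP.
have sp : (0 < size p)%N by rewrite size_poly_gt0 monic_neq0.
apply: (@root_int_algebraic q).
  apply/eqP => /polyP/(_ 0) /eqP; rewrite qi sp subn0 coef0.
  by move: mon_p; rewrite monicE lead_coefE => /eqP ->; rewrite oner_eq0.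
apply/rootP; rewrite (@horner_coef_wide _ (size p)); last first.
  by apply/leq_sizeP => j; rewrite qi ltnNge => ->.
have -> : \sum_(i < size p) (map_poly intr q)`_i * y^-1 ^+ i =
          y^-1 ^+ (size p).-1 * (map_poly intr p).[y].
  rewrite (@horner_coef_wide _ (size p)) ?size_poly // mulr_sumr (reindex_inj rev_ord_inj) /=.
  apply: eq_bigr => i _; rewrite qi rev_ord_proof coef_map /=.
  have le_i : (i <= (size p).-1)%N by rewrite -ltnS prednK.
  have -> : ((size p).-1 - (size p - i.+1) = i)%N by lia.
  have -> : (size p - i.+1 = (size p).-1 - i)%N by lia.
  rewrite mulrCA; congr (_ * _).
  by rewrite -{2}(subnK le_i) exprD -mulrA exprVn exprVn mulVf ?mulr1 ?expf_neq0.
by rewrite pdx mulr0.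
Qed.

End AlgebraicElements.

(** * Existence of rank one valuation rings *)

Section RankOneExistence.
Variable K : fieldType.
Implicit Types (O M : set K) (x y : K).
Local Notation int_integral := (integralOver (intr : int -> K)).

Definition int_image : set K := fun x => exists d : int, x = d%:~R.

Lemma int_image_subring : is_subring int_image.
Proof.
split; first by exists 1.
- by move=> _ _ [d ->] [e ->]; exists (d - e); rewrite intrB.
- by move=> _ _ [d ->] [e ->]; exists (d * e); rewrite intrM.
Qed.

Lemma coefs_in_int_image p : coefs_in int_image p -> exists q : {poly int}, p = map_poly intr q.
Proof.
move=> /choice[f fp]; exists (\poly_(i < size p) f i); apply/polyP => i.
rewrite coef_map coef_poly /=; case: ltnP => ip; first exact: fp.
by rewrite nth_default.
Qed.

Lemma monicize_val_ring O p x : val_ring O -> coefs_in O p -> p != 0 -> root p x ->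
  O (lead_coef p * x).
Proof.
move=> Oval Op p0 px; have Or := proj1 Oval.
apply: (val_ring_integral Oval) (monicize_monic p) (monicize_root p0 px) => i.
rewrite coefD coefXn coef_poly; apply: subringD => //.
  by case: eqP => _; [apply: subring1 | apply: subring0].
case: ifP => _; last exact: subring0.
by apply: subringM => //; apply: subringX => //; rewrite lead_coefE; apply: Op.
Qed.

(** It suffices to compare with one element [x]: every nonunit has a power divisible by [x], which
    [ex_max_avoiding] provides, and inverting [x] yields the whole field. *)
Lemma rank_oneI O x : val_ring O -> x != 0 ->
  (forall y, max_ideal O y -> exists k, O (y ^+ k / x)) ->
  (forall z, exists n, O (x ^+ n * z)) -> rank_one O.
Proof.
move=> Oval x0 Ox Oz; split=> // y my z; have Or := proj1 Oval.
have [k Ok] := Ox _ my; have [n On] := Oz z; exists (k * n)%N.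
have -> : y ^+ (k * n) * z = (y ^+ k / x) ^+ n * (x ^+ n * z).
  by rewrite exprM exprMn exprVn mulrA mulfVK // expf_neq0.
by apply: subringM => //; apply: subringX.
Qed.

Lemma nonzero_poly_factorX (p : {poly K}) : p != 0 ->
  exists k, exists2 q : {poly K}, q`_0 != 0 & p = q * 'X^k /\ forall i, q`_i = p`_(i + k).
Proof.
move=> p0; have exk : exists k, p`_k != 0.
  by exists (size p).-1; rewrite -lead_coefE lead_coef_eq0.
case: (ex_minnP exk) => k pk kmin; exists k, (drop_poly k p).
  by rewrite coef_drop_poly.
split; last by move=> i; rewrite coef_drop_poly.
rewrite -{1}(poly_take_drop k p) (_ : take_poly k p = 0) ?add0r //.
apply/polyP => i; rewrite coef_take_poly coef0; case: ltnP => // ik.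
by apply/eqP; apply: contraTT ik => /kmin; rewrite -leqNgt.
Qed.

(** Choose a subring [M] maximal among those over which [x] is transcendental. By maximality every
    [z] of [K] is a root of a nonzero polynomial over [M[x]]. Its leading coefficient is a power of
    [x] times a unit of the localization [R0], so some [x ^+ k * z] is integral over any valuation
    ring containing [R0]. *)
Lemma rank_one_transcendental x : ~ int_algebraic x ->
  exists2 O, rank_one O & max_ideal O x.
Proof.
move=> nax; pose Q M := forall p, coefs_in M p -> p.[x] = 0 -> p = 0.
have Q0 : Q int_image.
  move=> p /coefs_in_int_image[q ->] px; apply: contrapT => /eqP q0.
  by apply: nax; apply: (@root_int_algebraic _ q) => //; apply/rootP.
have [|M [Mr _ QM maxM]] := Zorn_subring int_image_subring Q0.
  move=> F [X0 FX0] totF FQ p Up px.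
  have [X FX Xp] : exists2 X, F X & forall i, (i < (size p).+1)%N -> X p`_i.
    elim: (size p).+1 => [|n [X FX IHn]]; first by exists X0.
    have [Y FY Yp] := Up n; have [XY|YX] := totF _ _ FX FY.
      exists Y => // i; rewrite ltnS leq_eqVlt => /predU1P[-> //|/IHn]; exact: XY.
    by exists X => // i; rewrite ltnS leq_eqVlt => /predU1P[->|/IHn //]; apply: YX.
  apply: (FQ X) => // i; have [/Xp//|ip] := ltnP i (size p).+1.
  by rewrite nth_default ?(ltnW ip) // -(nth_default 0 (leqnn (size p))); apply: Xp.
(* The localization of [M[x]] at the prime ideal generated by [x]. *)
pose R0 : set K := fun z => exists f g, [/\ coefs_in M f, coefs_in M g, g`_0 != 0 & z = f.[x] / g.[x]].
have gx0 g : coefs_in M g -> g != 0 -> g.[x] != 0 by move=> Mg; apply: contra_neq => /(QM _ Mg).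
have g00 (g : {poly K}) : g`_0 != 0 -> g != 0 by apply: contra_neq => ->; rewrite coef0.
have R0r : is_subring R0.
  split.
  - exists 1%:P, 1%:P; rewrite coefC !hornerC divr1 oner_eq0.
    by split=> //; apply: coefs_inC => //; apply: subring1.
  - move=> _ _ [f [g [Mf Mg g0 ->]]] [f' [g' [Mf' Mg' g0' ->]]].
    exists (f * g' - f' * g), (g * g'); rewrite coefM big_ord1 mulf_neq0 //.
    split=> //; [by apply: coefs_inB => //; apply: coefs_inM | exact: coefs_inM |].
    have := gx0 _ Mg (g00 _ g0); have := gx0 _ Mg' (g00 _ g0'); rewrite !hornerE => h1 h2.
    by field; rewrite h1 h2.
  - move=> _ _ [f [g [Mf Mg g0 ->]]] [f' [g' [Mf' Mg' g0' ->]]].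
    exists (f * f'), (g * g'); rewrite coefM big_ord1 mulf_neq0 //.
    split=> //; [exact: coefs_inM | exact: coefs_inM |].
    by rewrite !hornerM mulf_div.
have R0M f : coefs_in M f -> R0 f.[x].
  move=> Mf; exists f, 1%:P; rewrite coefC hornerC divr1 oner_eq0; split=> //.
  by apply: coefs_inC => //; apply: subring1.
have R0x : R0 x by rewrite -[x]hornerX; apply: R0M; apply: coefs_inX.
have x0 : x != 0.
  rewrite -[x]hornerX; apply: gx0; [exact: coefs_inX | by rewrite polyX_eq0].
have nR0x : ~ R0 x^-1.
  move=> [f [g [Mf Mg g0 /eqP]]].
  rewrite -div1r eqr_div ?gx0 ?g00 // mul1r -subr_eq0 => /eqP h.
  have : g - f * 'X = 0.
    apply: QM; last by rewrite !hornerE   .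
    by apply: coefs_inB => //; apply: coefs_inM => //; apply: coefs_inX.
  by move/polyP/(_ 0)/eqP; rewrite coefB coefMX subr0 coef0 (negPf g0).
have [O [Oval RO nOx Opow]] := ex_max_avoiding R0r R0x nR0x.
have Or := proj1 Oval.
exists O; last by right.
apply: (rank_oneI Oval x0 Opow).
move=> z; have [Mz|nMz] := pselect (M z).
  exists 0; rewrite mul1r; apply: RO; rewrite -[z](hornerC _ x); apply: R0M.
  exact: coefs_inC.
have [p [Mp px p0]] : exists p, [/\ coefs_in (adjoin M z) p, p.[x] = 0 & p != 0].
  apply: contrapT => np; apply: nMz; apply: (maxM (adjoin M z)).
  - exact: adjoin_subring.
  - exact: sub_adjoin.
  - by move=> p Mp px; apply/eqP/negPn/negP => p0; apply: np; exists p.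
  - exact: mem_adjoin.
have /choice[q qP] : forall i, exists q, coefs_in M q /\ p`_i = q.[z].
  by move=> i; have [q Mq e] := Mp i; exists q.
(* The relation for [x] over [M[z]] is regrouped by powers of [z]: the coefficient of [z ^+ j] is
   the element [(Qj j).[x]] of [M[x]]. *)
pose B := \max_(i < size p) size (q i).
pose Qj j := \poly_(i < size p) (q i)`_j.
have MQ j : coefs_in M (Qj j).
  move=> i; rewrite coef_poly; case: ifP => _; last exact: subring0.
  by case: (qP i).
pose P := \poly_(j < B) (Qj j).[x].
have Pz : root P z.
  apply/rootP; apply: etrans px; rewrite horner_poly [RHS]horner_coef.
  under eq_bigr do rewrite horner_poly mulr_suml.
  rewrite exchange_big /=; apply: eq_bigr => i _.
  rewrite (proj2 (qP i)) (@horner_coef_wide _ B) ?leq_bigmax // mulr_suml.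
  by apply: eq_bigr => j _; rewrite mulrAC.
have P0 : P != 0.
  have : lead_coef p != 0 by rewrite lead_coef_eq0.
  rewrite lead_coefE (proj2 (qP _)); set i := (size p).-1 => qi.
  have qi0 : q i != 0 by apply: contra_neq qi => ->; rewrite horner0.
  set j := (size (q i)).-1; have ip : (i < size p)%N by rewrite prednK ?size_poly_gt0.
  have jB : (j < B)%N.
    apply: leq_trans (leq_bigmax (Ordinal ip)) => /=.
    by rewrite prednK ?size_poly_gt0.
  have : P`_j != 0.
    rewrite coef_poly jB; apply: gx0 => //.
    have : (Qj j)`_i != 0 by rewrite coef_poly ip -lead_coefE lead_coef_eq0.
    by apply: contra_neq => ->; rewrite coef0.
  by apply: contra_neq => ->; rewrite coef0.
have OP : coefs_in O P.
  by move=> j; rewrite coef_poly; case: ifP => _; [apply/RO/R0M | apply: subring0].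
have := monicize_val_ring Oval OP P0 Pz.
have lP : lead_coef P = (Qj (size P).-1).[x].
  rewrite lead_coefE coef_poly; case: ifP => // /negP[].
  have : (0 < size P)%N by rewrite size_poly_gt0.
  have := size_poly B (fun j => (Qj j).[x]); rewrite -/P; lia.
have Q0' : Qj (size P).-1 != 0.
  by move: P0; rewrite -lead_coef_eq0 lP; apply: contra_neq => ->; rewrite horner0.
have [k [g g0 [gE gi]]] := nonzero_poly_factorX Q0'.
have Mg : coefs_in M g by move=> i; rewrite gi; apply: MQ.
rewrite lP gE hornerM hornerXn => OPz; exists k.
have -> : x ^+ k * z = (1 / g.[x]) * (g.[x] * x ^+ k * z).
  by rewrite -!mulrA mul1r mulKf // gx0 // g00.
apply: subringM => //; apply: RO; exists 1%:P, g; rewrite hornerC; split=> //.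
by apply: coefs_inC => //; apply: subring1.
Qed.
End RankOneExistence.

Section RankOneCharZero.
Variable K : fieldType.
Implicit Types (O M : set K) (x y : K).
Local Notation int_integral := (integralOver (intr : int -> K)).
Hypothesis char0 : forall d : int, d != 0 -> d%:~R != 0 :> K.

Lemma coefs_in_map_int O (p : {poly int}) : is_subring O -> coefs_in O (map_poly intr p).
Proof. by move=> Or i; rewrite coef_map; apply: subring_int. Qed.

Lemma horner_max_ideal O (p : {poly K}) x : val_ring O -> coefs_in O p -> max_ideal O x ->
  max_ideal O (p.[x] - p`_0).
Proof.
move=> Oval Op mx; have Or := proj1 Oval.
case sp: (size p) => [|n].
  have /eqP -> : p == 0 by rewrite -size_poly_eq0 sp.
  by rewrite horner0 coef0 subr0; left.
rewrite horner_coef sp big_ord_recl /= expr0 mulr1 addrAC subrr add0r.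
apply: max_ideal_sum => // i _; rewrite mulrC; apply: max_idealM => //.
exact: max_idealX.
Qed.

Lemma int_algebraic_root x : int_algebraic x ->
  exists2 p : {poly int}, p != 0 & root (map_poly intr p) x.
Proof.
move=> [d d0 [p mon_p pdx]].
have d0' : d != 0 by apply: contra_neq d0 => ->.
exists (p \Po (d *: 'X)).
  rewrite -lead_coef_eq0 lead_coef_comp; last by rewrite size_scale // size_polyX.
  rewrite mulf_neq0 ?lead_coef_eq0 ?monic_neq0 // expf_neq0 // lead_coefZ lead_coefX mulr1 //.
by rewrite map_comp_poly map_polyZ /= map_polyX /root horner_comp !hornerE.
Qed.

(** Split a primitive integer polynomial killing [x] at its first coefficient prime to [p], in
    degree [j]. The lower part [T] is divisible by [p], and the cofactor [W] of [x ^+ j] takes a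
    unit value because its constant term is a unit; so [x ^+ j / p = - (T / p)(x) / W(x)]. *)
Lemma prime_power_absorb O x (p : nat) : val_ring O -> prime p -> max_ideal O x ->
  int_algebraic x -> exists n, O (x ^+ n / p%:R).
Proof.
move=> Oval p_pr mx /int_algebraic_root[F0 F00 F0x]; have Or := proj1 Oval.
have p0 : p%:R != 0 :> K by apply: (@char0 p%:Z); rewrite -lt0n prime_gt0.
have [mp|nmp] := pselect (max_ideal O p%:R); last first.
  by exists 0%N; rewrite mul1r; case: (unit_inv nmp).
pose F := zprimitive F0.
have Fx : root (map_poly intr F) x.
  move: F0x; rewrite {1}[F0]zpolyEprim map_polyZ /= rootZ //; apply: char0.
  by rewrite zcontents_eq0.
have exj : exists j, ~~ (p%:Z %| F`_j)%Z.
  apply: contrapT => nj; have : (p%:Z %| zcontents F)%Z.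
    rewrite dvdz_contents; apply/polyOverP => i; apply: contrapT => /negP Fi.
    by apply: nj; exists i.
  rewrite zcontents_primitive F00 /= dvdz1 /= => /eqP p1; by rewrite p1 in p_pr.
case: (ex_minnP exj) => j jP jmin.
pose W := map_poly intr (drop_poly j F) : {poly K}.
pose T := map_poly intr (take_poly j F) : {poly K}.
have FTW : T.[x] + x ^+ j * W.[x] = 0.
  have := rootP Fx; rewrite -{1}(poly_take_drop j F) rmorphD rmorphM /= map_polyXn.
  by rewrite !hornerE mulrC.
have nmFj : ~ max_ideal O (F`_j)%:~R.
  move=> mFj; have : coprimez p F`_j.
    by rewrite /coprimez /gcdz -[_ == _]/(coprime _ _) absz_nat prime_coprime.
  move=> /coprimezP[[u v] /= uv]; apply: (not_max_ideal1 Oval).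
  have -> : 1 = p%:R * u%:~R + (F`_j)%:~R * v%:~R :> K.
    have := congr1 (intr : int -> K) uv; rewrite intrD !intrM => uv1.
    by transitivity (1%:~R : K) => //; rewrite -uv1 mulrC [X in _ + X]mulrC.
  by apply: max_idealD => //; apply: max_idealM => //; apply: subring_int.
have nmW : ~ max_ideal O W.[x].
  move=> mW; apply: nmFj.
  have -> : (F`_j)%:~R = W.[x] - (W.[x] - W`_0).
    by rewrite opprB addrC subrK coef_map coef_drop_poly.
  apply: max_idealD => //; apply: max_idealN => //.
  by apply: horner_max_ideal => //; apply: coefs_in_map_int.
have [W0 OW] := unit_inv nmW.
exists j; have -> : x ^+ j / p%:R = - (p%:R^-1 *: T).[x] / W.[x].
  rewrite hornerZ -mulrN; move/eqP: FTW; rewrite addrC addr_eq0 => /eqP <-.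
  by field; rewrite W0 p0.
apply: subringM => //; apply: subringN => //; apply: subring_horner => //; last exact: max_ideal_sub.
move=> i; rewrite coefZ coef_map coef_take_poly /=.
case: ltnP => ij; last by rewrite mulr0; apply: subring0.
have : (p%:Z %| F`_i)%Z by apply: contraTT ij => /jmin; rewrite -leqNgt.
by move/dvdzP => [u ->]; rewrite intrM mulrC mulfK //; apply: subring_int.
Qed.

(** Chevalley's construction is applied to [Z[x]], where [x] is not invertible. Every [z] becomes
    integral after multiplication by some nonzero integer [d], and a power of [x] absorbs [d] prime
    by prime. *)
Lemma rank_one_char0 x : (forall y, int_algebraic y) -> ~ int_integral x^-1 ->
  exists2 O, rank_one O & max_ideal O x.
Proof.
move=> alg nx.
have x0 : x != 0.
  by apply: contra_not_neq nx => ->; rewrite invr0; apply: integral0.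
have Rr : is_subring (adjoin (@int_image K) x) by apply: adjoin_subring (int_image_subring K).
have nRx : ~ adjoin (@int_image K) x x^-1.
  move=> [_ /coefs_in_int_image[q ->] xq]; apply: nx.
  (* Multiplying [x^-1 = q(x)] by [x^-1 ^+ (size q).-1] gives a monic integer equation for
     [x^-1]. *)
  exists ('X^(size q) - \poly_(i < size q) q`_((size q).-1 - i)).
    by rewrite monicE lead_coefDl ?lead_coefXn // size_polyN size_polyXn ltnS size_poly.
  rewrite rmorphB /= map_polyXn /root !hornerE.
  have -> : (map_poly intr (\poly_(i < size q) q`_((size q).-1 - i))).[x^-1] =
            x^-1 ^+ (size q).-1 * (map_poly intr q).[x].
    rewrite (@horner_coef_wide _ (size q)); last first.
      by apply: leq_trans (size_poly _ _) _; apply: size_poly.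
    rewrite (@horner_coef_wide _ (size q)) ?size_poly // mulr_sumr (reindex_inj rev_ord_inj) /=.
    apply: eq_bigr => i _; rewrite !coef_map coef_poly rev_ord_proof /=.
    have le_i : (i <= (size q).-1)%N by rewrite -ltnS prednK // (leq_ltn_trans _ (ltn_ord i)).
    have -> : ((size q).-1 - (size q - i.+1) = i)%N by lia.
    have -> : (size q - i.+1 = (size q).-1 - i)%N by lia.
    rewrite mulrCA; congr (_ * _).
    by rewrite -{2}(subnK le_i) exprD -mulrA !exprVn mulVf ?mulr1 ?expf_neq0.
  rewrite -xq -exprSr prednK ?subrr // size_poly_gt0.
  by apply/eqP => q0; move: xq; rewrite q0 rmorph0 horner0 => /eqP; rewrite invr_eq0 (negPf x0).
have [O [Oval RO nOx Opow]] := ex_max_avoiding Rr (mem_adjoin x (int_image_subring K)) nRx.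
have mx : max_ideal O x by right.
have Or := proj1 Oval.
exists O => //; apply: (rank_oneI Oval x0 Opow) => z.
have absorb (d : nat) : (0 < d)%N -> exists n, O (x ^+ n / d%:R).
  elim/ltn_ind: d => d IHd d0; have [d1|d1] := leqP d 1.
    by exists 0%N; rewrite (_ : d = 1%N); [rewrite mul1r invr1; apply: subring1|lia].
  have [n1 O1] := prime_power_absorb Oval (pdiv_prime d1) mx (alg x).
  have [||n2 O2] := IHd (d %/ pdiv d)%N.
  - by rewrite ltn_Pdiv // prime_gt1 // pdiv_prime.
  - by rewrite divn_gt0 ?pdiv_gt0 // dvdn_leq // pdiv_dvd.
  exists (n2 + n1)%N; rewrite -{1}(divnK (pdiv_dvd d)) natrM invfM exprD mulrACA.
  exact: subringM.
have [d d0 dz] := alg z.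
have dz' : O (d%:~R * z).
  by case: dz => p mp pz; apply: (val_ring_integral Oval (coefs_in_map_int p Or)) pz; rewrite monic_map.
have d0' : d != 0 by apply: contra_neq d0 => ->.
have [|n On] := absorb `|d|%N; first by rewrite absz_gt0.
exists n; have -> : x ^+ n * z = (x ^+ n / `|d|%N%:R) * ((`|d|%N%:R / d%:~R) * (d%:~R * z)).
  have : `|d|%N%:R != 0 :> K by apply: (@char0 `|d|%N); rewrite abszE Num.Theory.normr_eq0.
  by move=> h; field; rewrite h d0.
apply: subringM => //; apply: subringM => //.
case: d {dz dz' d0'} d0 On => k d0 _ /=; first by rewrite mulfV //; apply: subring1.
rewrite NegzE /= in d0 *.
by rewrite mulrNz oppr_eq0 in d0; rewrite mulrNz invrN mulrN mulfV //; apply: subringN => //; apply: subring1.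
Qed.
End RankOneCharZero.

(** Euclid's argument: with [u = P(0)], the value [P(u * D * k)] is [u] times a number congruent to
    1 modulo [D]. If that number divides a power of [D] it is a unit, so [P] would take the values
    [u] and [-u] too often. A zero value [P(c)] also satisfies the conclusion. *)
Lemma int_poly_value_new_prime (P : {poly int}) (D : int) : (1 < size P)%N -> D != 0 ->
  exists c, forall M, ~~ (P.[c] %| D ^+ M)%Z.
Proof.
move=> P1 D0; apply: contrapT => nc.
have {}nc c : exists M, (P.[c] %| D ^+ M)%Z.
  apply: contrapT => nM; apply: nc; exists c => M; apply/negP => PM.
  by apply: nM; exists M.
have DM0 M : D ^+ M != 0 by rewrite expf_neq0.
pose u := P.[0].
have u0 : u != 0.
  by have [M] := nc 0; rewrite -/u; apply: contraTneq => ->; rewrite dvd0z.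
have Pu k : P.[u * D * k] = u \/ P.[u * D * k] = - u.
  have [y Py] : exists y, P.[u * D * k] = u * (1 + D * y).
    exists (k * (drop_poly 1 P).[u * D * k]).
    rewrite -{1}(poly_take_drop 1 P) hornerD hornerM hornerXn expr1.
    have -> : (take_poly 1 P).[u * D * k] = u.
      by rewrite /u horner_poly big_ord1 expr0 mulr1 horner_coef0.
    ring.
  have [M] := nc (u * D * k); rewrite Py => /dvdzP[z Dz].
  have cop : coprimez (1 + D * y) (D ^+ M).
    apply: coprimezXr; apply/coprimezP; exists (1, - y) => /=; ring.
  have : (1 + D * y %| D ^+ M)%Z by apply/dvdzP; exists (z * u); rewrite Dz; ring.
  move/gcdz_idPl; rewrite (eqP cop); set w := 1 + D * y => w1.
  by have [->|->] : w = 1 \/ w = - 1 by [lia|]; rewrite ?mulr1 ?mulrN1; [left | right].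
pose Q := (P - u%:P) * (P + u%:P).
have Q0 : Q != 0.
  by rewrite mulf_neq0 // -size_poly_gt0 ?size_polyDl ?size_polyN ?size_polyC ?u0 // (ltnW P1).
pose rs := [seq u * D * k%:Z | k <- iota 0 (size Q)].
suff : (size rs < size Q)%N by rewrite size_map size_iota ltnn.
apply: (max_poly_roots Q0).
  apply/allP => _ /mapP[k _ ->]; rewrite rootM /root !hornerE.
  by case: (Pu k%:Z) => ->; rewrite ?subrr ?addNr ?eqxx ?orbT.
rewrite map_inj_uniq ?iota_uniq // => k l /mulfI.
by rewrite mulf_neq0 // => /(_ isT) [].
Qed.

(** * A valuation ring that the automorphism does not preserve *)

Section CyclicField.
Variables (K : fieldType) (sigma : {rmorphism K -> K}).
Local Notation int_integral := (integralOver (intr : int -> K)).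

(* [1 - (t - c) / (sigma t - c)] is the inverse of [(sigma t - c) / (sigma t - t)];
subtracting its values at [c = 0], [c = 1] and [c] recovers [c] and then [sigma t]. *)
Lemma translate_quotients_algebraic th :
  sigma th != th ->
  (forall th c, sigma th != th -> sigma c = c -> int_algebraic ((th - c) / (sigma th - c))) ->
  forall x : K, int_algebraic x.
Proof.
move=> th_moved alg.
have step t c : sigma t != t -> sigma c = c ->
    int_algebraic ((sigma t - c) / (sigma t - t)).
  move=> mt fc; have := alg _ _ mt fc => /(int_algebraicB (int_algebraic1 K)) /int_algebraicV.
  have d0 : sigma t - t != 0 by rewrite subr_eq0.
  have e0 : sigma t - c != 0.
    rewrite subr_eq0; apply: contra_neq mt => st; rewrite st; apply: (fmorph_inj sigma).
    by rewrite fc st.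
  rewrite (_ : (1 - _)^-1 = (sigma t - c) / (sigma t - t)) //.
  have -> : 1 - (t - c) / (sigma t - c) = (sigma t - t) / (sigma t - c) by field.
  by rewrite invf_div.
have fixed_quot t c : sigma t != t -> sigma c = c -> int_algebraic (c / (sigma t - t)).
  move=> mt fc; have := int_algebraicB (step _ _ mt (rmorph0 sigma)) (step _ _ mt fc).
  by rewrite subr0 -mulrBl opprB addrC subrK.
have inv_diff t : sigma t != t -> int_algebraic (sigma t - t).
  move=> mt; have /int_algebraicV := fixed_quot _ _ mt (rmorph1 sigma).
  by rewrite div1r invrK.
move=> x; have [fx|mx] := eqVneq (sigma x) x.
  rewrite -(mulfVK (_ : sigma th - th != 0) x) ?subr_eq0 //.
  by apply: int_algebraicM; [apply: fixed_quot | apply: inv_diff].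
have -> : x = sigma x - (sigma x - x) by rewrite opprB addrC subrK.
apply: int_algebraicB (inv_diff _ mx).
rewrite -(mulfVK (_ : sigma x - x != 0) (sigma x)) ?subr_eq0 //.
apply: int_algebraicM (inv_diff _ mx).
by have := step _ _ mx (rmorph0 sigma); rewrite subr0.
Qed.

(** If all these quotients were integral, subtracting 1 and clearing the denominator of
    [(sigma th - th)^-1] would give a single [d] with [d / (th - c)] integral for every integer [c].
    Then [F(c)], up to a leading coefficient a norm of [th - c], would divide a power of
    [lead_coef F * d] for all [c]. Pseudo-division over the integers replaces norms. *)
Lemma translate_quotient_not_integral th :
  (forall d : int, d != 0 -> d%:~R != 0 :> K) -> (forall x : K, int_algebraic x) ->
  sigma th != th ->
  exists c : int, ~ int_integral ((sigma th - c%:~R) / (th - c%:~R)).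
Proof.
move=> char0 alg mth; apply: contrapT => nc.
have {}nc c : int_integral ((sigma th - c%:~R) / (th - c%:~R)).
  by apply: contrapT => nint; apply: nc; exists c.
have thc c : th - c%:~R != 0.
  by rewrite subr_eq0; apply: contra_neq mth => ->; rewrite rmorph_int.
set delta := sigma th - th; have delta0 : delta != 0 by rewrite subr_eq0.
have [d d0 dint] := alg delta^-1.
have d0' : d != 0 by apply: contra_neq d0 => ->.
have wint c : int_integral (d%:~R / (th - c%:~R)).
  have := integral_mul dint (integral_sub (nc c) (integral1 _)).
  congr integralOver; have := thc c; rewrite /delta => h; field; exact/andP.
have exF : exists n, `[< exists2 F : {poly int}, F != 0 & size F = n /\ root (map_poly intr F) th >].
  have [F F0 Fth] := int_algebraic_root (alg th).
  by exists (size F); apply/asboolP; exists F.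
case: (ex_minnP exF) => n /asboolP[F F0 [sF Fth]] Fmin {exF}.
have map_neq0 (p : {poly int}) : p != 0 -> map_poly intr p != 0 :> {poly K}.
  rewrite -!lead_coef_eq0 => p0; rewrite lead_coef_map_eq ?char0 //.
have F1 : (1 < size F)%N.
  have := root_size_gt1 (map_neq0 _ F0) Fth; move/leq_trans; apply; exact: size_poly.
have D0 : lead_coef F * d != 0 by rewrite mulf_neq0 // lead_coef_eq0.
have [c /(_ _)/negP ncF] := int_poly_value_new_prime F1 D0.
have [h mon_h hw] := wint c.
pose M := (size h).-1.
(* This is [(X - c)^M * h(d / (X - c))]: it vanishes at [th], and at [c] only the term [i = M]
   survives. *)
pose H : {poly int} := \sum_(i < size h) (h`_i * d ^+ i) *: ('X - c%:P) ^+ (M - i).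
have Hc : H.[c] = d ^+ M.
  rewrite horner_sum; have sh : size h = M.+1 by rewrite prednK // size_poly_gt0 monic_neq0.
  rewrite sh big_ord_recr /= big1 ?add0r.
    by rewrite subnn expr0 !hornerE -[M]/((size h).-1) -lead_coefE (monicP mon_h) mul1r.
  move=> i _; rewrite !hornerE subrr expr0n subn_eq0 leqNgt ltn_ord /=; ring.
have Hth : root (map_poly intr H) th.
  rewrite /root rmorph_sum horner_sum /=.
  have e i : (i < size h)%N -> (map_poly intr ((h`_i * d ^+ i) *: ('X - c%:P) ^+ (M - i))).[th]
      = (th - c%:~R) ^+ M * ((h`_i)%:~R * (d%:~R / (th - c%:~R)) ^+ i).
    move=> ih; rewrite map_polyZ rmorphXn rmorphB /= map_polyX map_polyC /= !hornerE.
    have le_i : (i <= M)%N by rewrite -ltnS prednK // (leq_ltn_trans _ ih).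
    have tM : (th - c%:~R) ^+ M = (th - c%:~R) ^+ (M - i) * (th - c%:~R) ^+ i.
      by rewrite -exprD subnK.
    have tV : (th - c%:~R)^-1 ^+ i = ((th - c%:~R) ^+ i)^-1 by rewrite exprVn.
    rewrite tM exprMn tV intrM rmorphXn /=.
    have := expf_neq0 i (thc c); move: (_ ^+ i) (_ ^+ (M - i)) => u v u0.
    by field.
  under eq_bigr => i _ do rewrite e //.
  rewrite -mulr_sumr; move/rootP: hw.
  rewrite (@horner_coef_wide _ (size h)) ?size_poly // => hw.
  under eq_bigr do rewrite -coef_map.
  by rewrite hw mulr0.
(* The remainder kills [th] and is smaller than [F], so it is zero; evaluating at [c] gives the
   forbidden divisibility. *)
have := Pdiv.Idomain.divp_eq H F.
set k := Pdiv.Idomain.scalp H F.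
have -> : (H %% F)%R = 0.
  apply: contrapT => /eqP R0; have := Pdiv.Idomain.ltn_modp H F; rewrite F0 sF.
  have /Fmin : `[< exists2 F1 : {poly int}, F1 != 0 & size F1 = size (H %% F)%R /\ root (map_poly intr F1) th >].
    apply/asboolP; exists (H %% F)%R => //; split=> //.
    have := Pdiv.Idomain.divp_eq H F => /(congr1 (fun p => (map_poly intr p : {poly K}).[th])).
    rewrite rmorphD rmorphM /= map_polyZ !hornerE (rootP Fth) (rootP Hth) mulr0 mulr0 add0r.
    by move/esym/rootP.
  by rewrite leqNgt => /negPf ->.
rewrite addr0 => /(congr1 (horner^~ c)); rewrite !hornerE Hc => e.
apply: (ncF (k + M)%N); apply/dvdzP.
exists (lead_coef F ^+ M * d ^+ k * (H %/ F)%R.[c]).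
transitivity (lead_coef F ^+ M * d ^+ k * (lead_coef F ^+ k * d ^+ M)).
  rewrite exprMn !exprD.
  by move: (_ ^+ k) (_ ^+ M) (d ^+ k) (d ^+ M) => a b x z; ring.
by rewrite e mulrA.
Qed.

(** Either some translate quotient is not algebraic, or all of [K] is algebraic and the second
    hypothesis leaves characteristic zero. In both cases [c] is fixed by [sigma], so the quotient is
    [y / sigma y] for a translate [y] by [c]. *)
Lemma exists_unbalanced_valuation th :
  sigma th != th ->
  (exists x : K, ~ int_algebraic x) \/ (forall d : int, d != 0 -> d%:~R != 0 :> K) ->
  exists2 O, rank_one O & exists2 y, y != 0 & max_ideal O (y / sigma y).
Proof.
move=> mth big; have moved t c : sigma t != t -> sigma c = c -> t - c != 0.
  by move=> mt fc; rewrite subr_eq0; apply: contra_neq mt => ->.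
have [[t [c [mt fc nalg]]]|all_alg] := pselect (exists t c,
   [/\ sigma t != t, sigma c = c & ~ int_algebraic ((t - c) / (sigma t - c))]).
  have [O O1 mO] := rank_one_transcendental nalg; exists O => //; exists (t - c); first exact: moved.
  by rewrite rmorphB fc.
have alg : forall x : K, int_algebraic x.
  apply: (translate_quotients_algebraic mth) => t c mt fc.
  by apply: contrapT => nalg; apply: all_alg; exists t, c.
case: big => [[x nx]|char0]; first by case: nx.
have [c nint] := translate_quotient_not_integral char0 alg mth.
have [|O O1 mO] := rank_one_char0 char0 alg (x := (th - c%:~R) / (sigma th - c%:~R)).
  by rewrite invf_div.
exists O => //; exists (th - c%:~R); first by apply: moved; rewrite ?rmorph_int.
by rewrite rmorphB rmorph_int.
Qed.
End CyclicField.

Definition eventually (P : nat -> Prop) : Prop := exists N, forall n, (N <= n)%N -> P n.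

Lemma eventually_and P Q :
  eventually P -> eventually Q -> eventually (fun n => P n /\ Q n).
Proof.
move=> [N PN] [M QM]; exists (maxn N M) => n; rewrite geq_max => /andP[Nn Mn].
by split; [apply: PN | apply: QM].
Qed.

Lemma eventually_forall (I : finType) (P : I -> nat -> Prop) :
  (forall i, eventually (P i)) -> eventually (fun n => forall i, P i n).
Proof.
move=> /choice[N PN]; exists (\max_i N i) => n Nn i.
by apply: PN; apply: leq_trans Nn; apply: leq_bigmax.
Qed.

Lemma eventually_forall_lt (k : nat) (P : nat -> nat -> Prop) :
  (forall i, (i < k)%N -> eventually (P i)) ->
  eventually (fun n => forall i, (i < k)%N -> P i n).
Proof.
move=> Pk; have [N PN] := @eventually_forall 'I_k (fun i => P i) (fun i => Pk i (ltn_ord i)).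
by exists N => n /PN Pn i ik; apply: (Pn (Ordinal ik)).
Qed.

Lemma eventually_mono (P Q : nat -> Prop) :
  eventually P -> (forall n, P n -> Q n) -> eventually Q.
Proof. by move=> [N PN] PQ; exists N => n /PN /PQ. Qed.

Lemma eventually_pos : eventually (fun n => 0 < n)%N.
Proof. by exists 1%N. Qed.

Lemma rank_one_eventually (K : fieldType) (O : set K) x y :
  rank_one O -> max_ideal O x -> eventually (fun n => max_ideal O (x ^+ n * y)).
Proof.
move=> [Oval Oarch] mx; have [N ON] := Oarch _ mx y; exists N.+1 => n Nn.
have -> : x ^+ n * y = x ^+ (n - N.+1).+1 * (x ^+ N * y).
  by rewrite mulrA -exprD; congr (x ^+ _ * _); lia.
by apply: max_idealM => //; apply: max_idealX.
Qed.

(** * Weak approximation for the conjugates of a valuation *)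

Section IteratedMorphism.
Variables (K : fieldType) (sigma : {rmorphism K -> K}).
Definition morph_iter i : K -> K := iter i sigma.

Lemma morph_iter_is_zmod_morphism i : zmod_morphism (morph_iter i).
Proof. by move=> x y; elim: i => //= i ->; rewrite rmorphB. Qed.
Lemma morph_iter_is_monoid_morphism i : monoid_morphism (morph_iter i).
Proof.
split; first by elim: i => //= i ->; rewrite rmorph1.
by move=> x y; elim: i => //= i ->; rewrite rmorphM.
Qed.
HB.instance Definition _ i :=
  GRing.isZmodMorphism.Build K K (morph_iter i) (morph_iter_is_zmod_morphism i).
HB.instance Definition _ i :=
  GRing.isMonoidMorphism.Build K K (morph_iter i) (morph_iter_is_monoid_morphism i).

Lemma morph_iterD i j x : morph_iter (i + j) x = morph_iter i (morph_iter j x).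
Proof. exact: iterD. Qed.
Lemma morph_iterS i x : morph_iter i.+1 x = sigma (morph_iter i x).
Proof. by []. Qed.
Lemma morph_iterSr i x : morph_iter i.+1 x = morph_iter i (sigma x).
Proof. exact: iterSr. Qed.
End IteratedMorphism.

Section CyclicValuation.
Variables (K : fieldType) (sigma : {rmorphism K -> K}) (q : nat) (O : set K).
Hypotheses (q_pr : prime q) (sigmaq : forall x, morph_iter sigma q x = x).
Hypothesis O1 : rank_one O.
Local Notation s := (morph_iter sigma).
Local Notation m := (max_ideal O).
Let Oval : val_ring O := proj1 O1.
Let Oring : is_subring O := proj1 Oval.

Lemma morph_iter_mulq k x : s (k * q) x = x.
Proof. by elim: k => // k IHk; rewrite mulSn morph_iterD IHk sigmaq. Qed.

Lemma morph_iter_modq k x : s k x = s (k %% q) x.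
Proof. by rewrite {1}(divn_eq k q) morph_iterD morph_iter_mulq. Qed.

Variable y : K.
Hypotheses (y0 : y != 0) (my : m (y / sigma y)).

(** As [k] is invertible modulo [q], stability under [s k] implies stability under every [s i]. The
    product of the conjugates of [y / sigma y] would then lie in the maximal ideal, but it
    telescopes to 1. *)
Lemma conjugate_ring_neq k : ~~ (q %| k)%N -> exists2 x, O x & ~ O (s k x).
Proof.
move=> qk; apply: contrapT => nx.
have Ok x : O x -> O (s k x) by move=> Ox; apply: contrapT => nOx; apply: nx; exists x.
have Okj j x : O x -> O (s (k * j) x).
  by elim: j => [|j IHj] Ox; rewrite ?muln0 // mulnS morph_iterD; apply: Ok; apply: IHj.
have [j kj] : exists j, (k * j = 1 %[mod q])%N.
  have k0 : (0 < k)%N by case: k qk {nx Ok Okj} => //; rewrite dvdn0.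
  have [j l e _] := egcdnP q k0; exists j.
  have cop : gcdn k q = 1%N by apply/eqP; rewrite -[_ == _]/(coprime k q) coprime_sym prime_coprime.
  by rewrite mulnC e cop modnMDl.
have Os i x : O x -> O (s i x).
  move=> Ox; elim: i => // i IHi; rewrite -addn1 addnC morph_iterD.
  rewrite (_ : s 1 _ = s (k * j) (s i x)); first exact: Okj.
  by rewrite morph_iter_modq -kj -morph_iter_modq.
have ms i z : m z -> m (s i z).
  case=> [->|nOz]; first by rewrite rmorph0; left.
  right; rewrite -fmorphV => Osz; apply: nOz.
  rewrite -(morph_iter_mulq i z^-1) -(subnK (leq_pmulr i (prime_gt0 q_pr))) morph_iterD.
  exact: Os.
have prod1 n : \prod_(i < n) s i (y / sigma y) = y / s n y.
  elim: n => [|n IHn]; first by rewrite big_ord0 mulfV.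
  rewrite big_ord_recr IHn /= rmorphM fmorphV /= -morph_iterSr mulrA mulfVK //.
  by rewrite fmorph_eq0.
apply: (not_max_ideal1 Oval).
have <- : \prod_(i < q) s i (y / sigma y) = 1 by rewrite prod1 sigmaq mulfV.
rewrite -(prednK (prime_gt0 q_pr)) big_ord_recr /= mulrC; apply: max_idealM => //; first exact: ms.
have big1O n : O (\prod_(i < n) s i (y / sigma y)).
  elim: n => [|n IHn]; rewrite ?big_ord0 ?big_ord_recr; first exact: subring1.
  by apply: subringM => //; apply: max_ideal_sub => //; apply: ms.
exact: big1O.
Qed.

Lemma separate_conjugate k : ~~ (q %| k)%N -> exists2 x, ~ O x & O (s k x).
Proof.
move=> qk; have q0 := prime_gt0 q_pr; pose k' := ((q - k %% q))%N.
have kq : (k %% q < q)%N by rewrite ltn_mod.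
have qk' : ~~ (q %| k')%N.
  apply: contra qk => qk'; have := dvdn_sub (dvdnn q) qk'; rewrite subKn ?(ltnW kq) //.
  by rewrite /dvdn modn_mod.
have [x Ox nOx] := conjugate_ring_neq qk'; exists (s k' x) => //.
rewrite (morph_iter_modq k) -morph_iterD subnKC ?(ltnW kq) // sigmaq //.
Qed.

Lemma strictly_separate_conjugate k : ~~ (q %| k)%N -> exists2 x, ~ O x & m (s k x).
Proof.
move=> qk; have [x nOx Okx] := separate_conjugate qk.
have [z Oz nOz] := conjugate_ring_neq qk; exists (x / z).
  move=> Oxz; apply: nOx; have [z0|z0] := eqVneq z 0.
    by case: nOz; rewrite z0 rmorph0; apply: subring0.
  by rewrite -(mulfVK z0 x); apply: subringM.
rewrite rmorphM fmorphV /= mulrC; apply: max_idealM => //; exact: max_ideal_inv.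
Qed.

Lemma not_valM x z : ~ O x -> O z -> O z^-1 -> z != 0 -> ~ O (x * z).
Proof.
by move=> nOx Oz Oz' z0 Oxz; apply: nOx; rewrite -(mulfK z0 x); apply: subringM.
Qed.

Lemma not_valP x : ~ O x <-> x != 0 /\ m x^-1.
Proof.
split=> [nOx|[x0 mx]].
  split; last exact: max_ideal_inv.
  by apply: contra_not_neq nOx => ->; apply: subring0.
by have := not_max_ideal_inv _ mx; rewrite invrK invr_eq0; apply.
Qed.

(** The induction of the weak approximation theorem: [x] handles the new conjugate, [z] the earlier
    ones, and rank one lets a power of [z] outweigh [x]. If [z] is integral at the new conjugate,
    [x] times a power of [z] works. *)
Lemma separate_all_conjugates n : (n < q)%N ->
  exists2 z, ~ O z & forall i, (i < n)%N -> m (s i.+1 z).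
Proof.
elim: n => [|n IHn] nq.
  exists (y / sigma y)^-1 => //; apply/not_valP; rewrite invrK; split=> //.
  by rewrite invr_eq0 mulf_neq0 // invr_eq0 fmorph_eq0.
have [z nOz mz] := IHn (ltnW nq).
have qn : ~~ (q %| n.+1)%N by rewrite gtnNdvd.
have [x nOx mx] := strictly_separate_conjugate qn.
have /not_valP[z0 mz'] := nOz; have /not_valP[x0 mx'] := nOx.
have ev c : eventually (fun N => forall i, (i < n)%N -> m (s i.+1 z ^+ N * c i)).
  by apply: eventually_forall_lt => i /mz mi; apply: rank_one_eventually.
have [N HN] := eventually_and (ev (fun i => s i.+1 x)) eventually_pos.
have [Hi N0] := HN N (leqnn N); case: N N0 {HN} Hi => // N _ Hi.
have [On|nOn] := pselect (O (s n.+1 z)).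
  exists (x * z ^+ N.+1).
    apply/not_valP; rewrite mulf_neq0 ?expf_neq0 // invfM; split=> //.
    rewrite -exprVn; apply: max_idealM => //; apply: subringX => //; exact: max_ideal_sub.
  move=> i; rewrite ltnS leq_eqVlt => /predU1P[->|ni]; rewrite rmorphM rmorphXn /=.
    by apply: max_idealM => //; apply: subringX.
  by rewrite mulrC; apply: Hi.
have unit1 v : m v -> [/\ 1 + v ^+ N.+1 != 0, O (1 + v ^+ N.+1) & O (1 + v ^+ N.+1)^-1].
  move=> mv; have mvN := max_idealX Oval N mv.
  have [h1 h2] := max_ideal_unit1 Oval mvN; split=> //.
  by apply: subringD => //; [apply: subring1 | apply: max_ideal_sub].
(* Here [z] is large at the new conjugate. The factor is [z^(N+1) / (1 + z^(N+1))]: a unit where [z]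
   is large, small where [z] is small. *)
exists (x / (1 + z^-1 ^+ N.+1)).
  by have [u0 Ou Ou'] := unit1 _ mz'; apply: not_valM; rewrite ?invrK ?invr_eq0.
have e i : s i.+1 (x / (1 + z^-1 ^+ N.+1)) = s i.+1 x / (1 + (s i.+1 z)^-1 ^+ N.+1).
  by rewrite rmorphM fmorphV rmorphD rmorph1 rmorphXn fmorphV.
move=> i; rewrite ltnS leq_eqVlt e => /predU1P[->|ni].
  have [_ _ ?] := unit1 _ (max_ideal_inv nOn); exact: max_idealM.
set u := s i.+1 z; have u0 : u != 0 by rewrite fmorph_eq0.
have [u1 _ ?] := unit1 _ (mz i ni).
have -> : s i.+1 x / (1 + u^-1 ^+ N.+1) = (u ^+ N.+1 * s i.+1 x) * (1 + u ^+ N.+1)^-1.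
  have uN0 : u ^+ N.+1 != 0 by rewrite expf_neq0.
  have u1' : 1 + u ^+ N.+1 != 0 by [].
  rewrite exprVn; move: (u ^+ N.+1) uN0 u1' => w w0 w1.
  by have w1' : w + 1 != 0 by [rewrite addrC]; field; rewrite ?w0 ?w1 ?w1'.
by apply: max_idealM => //; apply: Hi.
Qed.

(** Adding 1 to a separating [z] gives an [a] that is large at one place and a unit at all other
    conjugates. The quotient [a / sigma a] has norm 1 by telescoping; its conjugate of index 0 is
    large, that of index [q.-1] is small, and the rest are units. *)
Lemma exists_hyperbolic_norm_one :
  exists g, [/\ g != 0, \prod_(i < q) s i g = 1,
    forall j, (0 < j < q)%N -> m (s j g / g) &
    forall j, (j < q.-1)%N -> m (s q.-1 g / s j g)].
Proof.
have q1 := prime_gt1 q_pr; have [|z nOz mz] := @separate_all_conjugates q.-1.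
  by rewrite prednK // ltnW.
pose a := 1 + z.
have /not_valP[a0 ma] : ~ O a.
  move=> Oa; apply: nOz; have -> : z = a - 1 by rewrite addrAC subrr add0r.
  by apply: subringB => //; apply: subring1.
have unit_a i : (0 < i < q)%N -> O (s i a) /\ O (s i a)^-1.
  case: i => // i /andP[_ iq]; rewrite /a rmorphD rmorph1.
  have mi : m (s i.+1 z) by apply: mz; rewrite -ltnS prednK // ltnW.
  have [_ h] := max_ideal_unit1 Oval mi; split=> //.
  by apply: subringD => //; [apply: subring1 | apply: max_ideal_sub].
have sa0 i : s i a != 0 by rewrite fmorph_eq0.
pose g := a / sigma a.
have sg i : s i g = s i a / s i.+1 a by rewrite rmorphM fmorphV /= -morph_iterSr.
have g0 : g != 0 by rewrite mulf_neq0 ?invr_eq0 ?fmorph_eq0.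
have prod1 n : \prod_(i < n) s i g = a / s n a.
  elim: n => [|n IHn]; first by rewrite big_ord0 mulfV.
  by rewrite big_ord_recr IHn /= sg mulrA mulfVK.
have sq : s q.-1.+1 a = a by rewrite prednK ?sigmaq // ltnW.
have mid j : (0 < j < q.-1)%N -> O (s j g) /\ O (s j g)^-1.
  move=> jq; have [|O1' O1''] := unit_a j; first by lia.
  have [|O2' O2''] := unit_a j.+1; first by lia.
  by rewrite sg invf_div; split; apply: subringM.
have mg : m g^-1.
  rewrite invf_div mulrC; apply: max_idealM => //.
  by have [] := unit_a 1%N _; rewrite ?q1.
have mgq : m (s q.-1 g).
  rewrite sg sq mulrC; apply: max_idealM => //.
  by have [|] := unit_a q.-1; first by lia.
exists g; split=> //.
- by rewrite prod1 sigmaq mulfV.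
- move=> j jq; rewrite mulrC; apply: max_idealM => //.
  have [->|jq'] := eqVneq j q.-1; first exact: max_ideal_sub.
  by have [|] := mid j; first by lia.
- move=> j jq; apply: max_idealM => //; have [->|j0] := posnP j; first exact: max_ideal_sub.
  by have [|] := mid j; first by rewrite j0.
Qed.

End CyclicValuation.

(** * Ping-pong *)

Section PingPong.
Variables (K : fieldType) (O : set K) (n : nat).
Hypothesis O1 : rank_one O.
Local Notation m := (max_ideal O).
Let Oval : val_ring O := proj1 O1.
Let Oring : is_subring O := proj1 Oval.

Lemma dominant_sum (k : nat) (c r : 'I_k -> K) (e : 'I_k) : c e != 0 -> r e != 0 ->
  (forall i, i != e -> c i != 0 -> m (r i / r e)) ->
  eventually (fun N => \sum_i c i * r i ^+ N != 0).
Proof.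
move=> ce re dom.
have ev i : eventually (fun N => i != e -> m ((r i / r e) ^+ N * (c i / c e))).
  have [->|ie] := eqVneq i e; first by exists 0%N.
  have [->|ci] := eqVneq (c i) 0; first by exists 0%N => N _ _; rewrite mul0r mulr0; left.
  by apply: (eventually_mono (rank_one_eventually (c i / c e) O1 (dom _ ie ci))) => N h _; exact: h.
apply: (eventually_mono (eventually_forall ev)) => N domN.
rewrite (bigD1 e) //=.
have -> : \sum_(i < k | i != e) c i * r i ^+ N =
    (c e * r e ^+ N) * \sum_(i < k | i != e) (r i / r e) ^+ N * (c i / c e).
  rewrite mulr_sumr; apply: eq_bigr => i _; rewrite exprMn exprVn.
  have := expf_neq0 N re; move: (r e ^+ N) (r i ^+ N) => u v u0.
  by field; rewrite u0 ce.
have [h _] := max_ideal_unit1 Oval (max_ideal_sum Oval (index_enum _) domN).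
by rewrite -{1}[c e * _]mulr1 -mulrDr mulf_neq0 // mulf_neq0 // expf_neq0.
Qed.

Variable d : 'I_n.+2 -> K.
Hypotheses (d0 : forall i, d i != 0) (dmax : forall i, i != ord0 -> m (d i / d ord0))
  (dmin : forall i, i != ord_max -> m (d ord_max / d i)).

(* The indices of the strictly largest and of the strictly smallest [d i]. *)
Definition pole (b : bool) : 'I_n.+2 := if b then ord0 else ord_max.

Lemma pole_neq b : pole (~~ b) != pole b.
Proof. by case: b. Qed.

(** With the sign absorbed, [pole b] is the strictly dominant index of [dsign b] for both values of
    [b]. *)
Definition dsign b i := if b then d i else (d i)^-1.

Lemma dsign_neq0 b i : dsign b i != 0.
Proof. by rewrite /dsign; case: b; rewrite ?invr_eq0. Qed.

Lemma dsign_dom b i : i != pole b -> m (dsign b i / dsign b (pole b)).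
Proof. by case: b => /= ib; rewrite ?invrK 1?mulrC; [rewrite mulrC; apply: dmax | apply: dmin]. Qed.

Lemma dsign_sub b i : i != pole (~~ b) -> m (dsign b (pole (~~ b)) / dsign b i).
Proof. by case: b => /= ib; rewrite ?invrK 1?mulrC; [rewrite mulrC; apply: dmin | apply: dmax]. Qed.

Definition dmx b N : 'M[K]_n.+2 := diag_mx (\row_i dsign b i ^+ N).

Lemma dmxM b N : dmx b N *m dmx (~~ b) N = 1%:M.
Proof.
rewrite mulmx_diag; apply/matrixP => i j; rewrite !mxE; congr (_ *+ _).
by rewrite -exprMn /dsign; case: b => /=; rewrite ?mulfV ?mulVf ?expr1n.
Qed.

Lemma conj_dmxE (V U : 'M[K]_n.+2) b N i j :
  (V *m dmx b N *m U) i j = \sum_k (V i k * U k j) * dsign b k ^+ N.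
Proof.
by rewrite mul_mx_diag mxE; apply: eq_bigr => k _; rewrite !mxE mulrAC.
Qed.

Lemma invmx_unique (A B : 'M[K]_n.+2) : A *m B = 1%:M -> A \in unitmx /\ invmx A = B.
Proof.
move=> AB; have [uA uB] := mulmx1_unit AB; split=> //.
by rewrite -[LHS]mulmx1 -AB mulKmx.
Qed.

Lemma conj_dmx_inv (U : 'M[K]_n.+2) b N : U \in unitmx ->
  (invmx U *m dmx b N *m U) *m (invmx U *m dmx (~~ b) N *m U) = 1%:M.
Proof.
move=> uU; rewrite !mulmxA mulmxK // -!mulmxA (mulmxA (dmx b N)) dmxM mul1mx mulVmx //.
Qed.

(** [S] and its inverse move each basis vector at a pole off the hyperplanes where a pole coordinate
    vanishes. These are the attracting points and repelling hyperplanes of the diagonal matrix and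
    its inverse. *)
Definition generic (S : 'M[K]_n.+2) : Prop :=
  S \in unitmx /\ forall b c, S (pole b) (pole c) != 0 /\ invmx S (pole b) (pole c) != 0.

Lemma generic_conj (U : 'M[K]_n.+2) : U \in unitmx ->
  (forall s b c, exists2 e, invmx U (pole b) e * U e (pole c) != 0 &
     forall k, k != e -> invmx U (pole b) k * U k (pole c) != 0 -> m (dsign s k / dsign s e)) ->
  eventually (fun N => generic (invmx U *m dmx true N *m U)).
Proof.
move=> uU dom.
have ev (t : bool * bool * bool) : eventually (fun N =>
    (invmx U *m dmx t.1.1 N *m U) (pole t.1.2) (pole t.2) != 0).
  case: t => [[s b] c] /=; have [e e0 domk] := dom s b c.
  by apply: (eventually_mono (dominant_sum e0 (dsign_neq0 s e) domk)) => N; rewrite conj_dmxE.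
apply: (eventually_mono (eventually_forall ev)) => N evN.
have [uW WV] := invmx_unique (conj_dmx_inv true N uU).
split=> // b c; rewrite WV; split; [exact: (evN (true, b, c)) | exact: (evN (false, b, c))].
Qed.

Lemma generic_step (U : 'M[K]_n.+2) : generic U ->
  eventually (fun N => generic (invmx U *m dmx true N *m U)).
Proof.
move=> [uU gU]; apply: generic_conj => // s b c; exists (pole s).
  by rewrite mulf_neq0 //; [case: (gU b s) | case: (gU s c)].
by move=> k ks _; apply: dsign_dom.
Qed.

Variable b : K.
Hypothesis b0 : b != 0.

(** Multiplication by [h] in the basis of its powers, with [b] for [h ^+ n.+2]. *)
Definition shift_mx : 'M[K]_n.+2 :=
  \matrix_(i, j) if (i == 0%N :> nat) then (if j == ord_max then b else 0)
                 else (i == j.+1 :> nat)%:R.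

Local Notation U := (1%:M + shift_mx).

(** Along a column of the inverse, cyclically consecutive entries determine each other up to sign
    and the factor [b], except at the index [j]. One zero therefore spreads to the whole column,
    contradicting the equation with right-hand side 1 at [j]. *)
Lemma inv_shift_neq0 : U \in unitmx -> forall i j, invmx U i j != 0.
Proof.
move=> uU i j; set V := invmx U; pose y k := V (inord k) j.
have rec k : (k < n.+1)%N -> y k.+1 + y k = (k.+1 == j :> nat)%:R.
  move=> kn; have := mulmxV uU => /matrixP/(_ (inord k.+1) j).
  rewrite mulmxDl mul1mx !mxE -/V -/(y k.+1).
  rewrite (bigD1 (inord k)) //= big1 ?addr0 => [|l lk].
    rewrite !mxE !inordK ?ltnS // ?(ltnW kn) // eqxx mul1r -/(y k) => ->.
    by rewrite -val_eqE /= inordK.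
  rewrite !mxE inordK ?ltnS //= eqSS (_ : (k == l :> nat) = false) ?mul0r //.
  by apply: contraNF lk => /eqP kl; rewrite kl inord_val.
have rec0 : y 0%N + b * y n.+1 = (0%N == j :> nat)%:R.
  have := mulmxV uU => /matrixP/(_ (inord 0) j).
  rewrite mulmxDl mul1mx !mxE -/V -/(y 0%N).
  rewrite (bigD1 ord_max) //= big1 ?addr0 => [|l lk].
    have -> : V ord_max j = y n.+1 by congr (V _ j); apply: val_inj; rewrite /= inordK.
    by rewrite !mxE !inordK // !eqxx /= => ->; rewrite -val_eqE /= inordK.
  by rewrite !mxE inordK //= (negPf lk) mul0r.
pose Z k := y k == 0.
have ZS k : (k < n.+1)%N -> k.+1 != j :> nat -> Z k = Z k.+1.
  move=> kn /negPf kj; have := rec k kn; rewrite kj => /eqP; rewrite addr_eq0 => /eqP e.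
  by rewrite /Z e oppr_eq0.
have Zlow k : (k < j)%N -> Z k = Z 0%N.
  elim: k => // k IHk kj; rewrite -IHk; last exact: ltnW.
  by rewrite -ZS ?ltn_eqF //; have := ltn_ord j; lia.
have Zhigh k : (j <= k <= n.+1)%N -> Z k = Z j.
  case/andP=> /subnK <-; elim: (k - j)%N => // l IHl ln; rewrite -IHl; last exact: ltnW.
  by rewrite addSn -ZS // -addSn gtn_eqF // addSn ltnS leq_addl.
have jn : (j <= n.+1)%N by rewrite -ltnS.
have contra : Z j -> Z (if j == 0%N :> nat then n.+1 else j.-1) -> False.
  case: ifP => [/eqP j00|/negbT j00] /eqP h1 /eqP h2.
    by have /eqP := rec0; rewrite h2 j00 -{1}j00 h1 mulr0 addr0 eqxx eq_sym oner_eq0.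
  have := rec j.-1; rewrite prednK ?lt0n // => /(_ jn) /eqP.
  by rewrite h1 h2 addr0 eqxx eq_sym oner_eq0.
have Zmax0 : j != 0%N :> nat -> Z n.+1 = Z 0%N.
  rewrite eq_sym => /negPf j00; have := rec0; rewrite j00 => /eqP; rewrite addr_eq0 => /eqP e.
  by rewrite /Z e oppr_eq0 mulf_eq0 (negPf b0).
have Zmaxj : Z n.+1 = Z j by apply: Zhigh; rewrite jn leqnn.
apply/negP => Vij; have Zi : Z i by rewrite /Z /y inord_val.
have Zj : Z j.
  have [ij|ji] := ltnP i j; last by rewrite -(Zhigh i) // ji -ltnS ltn_ord.
  by rewrite -Zmaxj Zmax0 -?(Zlow i) // -lt0n (leq_ltn_trans _ ij).
apply: (contra Zj); case: ifP => [_|/negbT j00]; first by rewrite Zmaxj.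
by rewrite Zlow ?prednK ?lt0n // -Zmax0 // Zmaxj.
Qed.

(** A pole column of [U] has just two nonzero entries, so the sum has two terms. If the pole of the
    column is dominant its own term wins; otherwise it is the weakest index and the other term [nx]
    wins. *)
Lemma generic_base : U \in unitmx -> eventually (fun N => generic (invmx U *m dmx true N *m U)).
Proof.
move=> uU; apply: generic_conj => // s a c; set j := pole c.
pose nx : 'I_n.+2 := if c then inord 1 else ord0.
have nxj : nx != j by rewrite /nx /j; case: (c) => //; rewrite -val_eqE /= inordK.
have Uj : U j j != 0.
  rewrite !mxE eqxx; case: ifP => [j00|_].
    have -> : (j == ord_max) = false by move: j00; rewrite /j /pole; case: (c).
    by rewrite addr0 oner_eq0.
  by rewrite -[j.+1]addn1 -{1}[j : nat]addn0 eqn_add2l addr0 oner_eq0.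
have Unx : U nx j != 0.
  rewrite !mxE (negPf nxj) add0r /nx /j; case: (c) => /=; last by rewrite eqxx.
  by rewrite inordK //= oner_eq0.
have U0 k : k != j -> k != nx -> U k j = 0.
  move=> kj knx; rewrite !mxE (negPf kj) add0r; move: kj knx; rewrite /nx /j.
  case: (c) => /= kj knx.
    rewrite -val_eqE /= in kj; rewrite (negPf kj).
    by move: knx; rewrite -val_eqE /= inordK // => /negPf ->.
  rewrite -val_eqE /= in knx; rewrite (negPf knx) ltn_eqF //.
have V0 := inv_shift_neq0 uU.
have [cs|cs] := eqVneq c s.
  exists j; first by rewrite mulf_neq0.
  by move=> k kj _; rewrite /j cs; apply: dsign_dom; rewrite -cs.
exists nx; first by rewrite mulf_neq0.
move=> k knx; have [->|kj] := eqVneq k j; last by rewrite (U0 _ kj knx) mulr0 eqxx.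
have cE : c = ~~ s by case: (c) (s) cs => [] [].
by move=> _; rewrite /j cE; apply: dsign_sub; rewrite -cE.
Qed.

(** The frame of a generator: [false] is the diagonal matrix, [true] its conjugate by [S]. *)
Definition side (S : 'M[K]_n.+2) (t : bool) : 'M[K]_n.+2 := if t then S else 1%:M.

Definition letter_mx (S : 'M[K]_n.+2) N (l : bool * bool) : 'M[K]_n.+2 :=
  side S l.1 *m dmx l.2 N *m side (invmx S) l.1.

Definition word_mx S N (w : seq (bool * bool)) : 'M[K]_n.+2 :=
  foldr (fun l acc => letter_mx S N l *m acc) 1%:M w.

Fixpoint reduced (w : seq (bool * bool)) : bool :=
  match w with
  | l1 :: ((l2 :: _) as w') => ~~ ((l1.1 == l2.1) && (l1.2 != l2.2)) && reduced w'
  | _ => true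
  end.

Section Attraction.
Variables (S : 'M[K]_n.+2) (p : K) (k : nat).
Hypotheses (uS : S \in unitmx) (p0 : p != 0) (mp : m p).
Hypothesis dom : forall t a c i j, 
  let T := if t then S else invmx S in
  T (pole a) (pole c) != 0 /\ m (p ^+ k * (T i j / T (pole a) (pole c))).

(** A neighborhood of a projective point: the other coordinates are at most [|p|^(k+1)] times the
    one at [pole a]. *)
Definition near_pole a (x : 'cV[K]_n.+2) : Prop :=
  x (pole a) 0 != 0 /\
  forall i, i != pole a -> O (x i 0 / (p ^+ k.+1 * x (pole a) 0)).

(** Away from the repelling hyperplane of [dmx a]: coordinates are at most [|p|^(-k)] times the one
    at [pole a]. The extra factor [p] in [near_pole] keeps this region disjoint from the
    neighborhood of the opposite pole. *)
Definition off_pole a (x : 'cV[K]_n.+2) : Prop :=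
  x (pole a) 0 != 0 /\ forall i, O (p ^+ k * (x i 0 / x (pole a) 0)).

Lemma near_pole_ratio a x : near_pole a x ->
  forall i, O (x i 0 / x (pole a) 0) /\ (i != pole a -> exists2 o, O o & x i 0 / x (pole a) 0 = p ^+ k.+1 * o).
Proof.
move=> [xa xi] i; have pk : p ^+ k.+1 != 0 by rewrite expf_neq0.
have Op : O (p ^+ k.+1) by apply: subringX => //; apply: max_ideal_sub.
have h : i != pole a -> exists2 o, O o & x i 0 / x (pole a) 0 = p ^+ k.+1 * o.
  move=> ia; exists (x i 0 / (p ^+ k.+1 * x (pole a) 0)); first exact: xi.
  by move: (p ^+ k.+1) pk => P P0; field; rewrite P0 xa.
split=> //; have [->|ia] := eqVneq i (pole a); first by rewrite mulfV //; apply: subring1.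
by have [o Oo ->] := h ia; apply: subringM.
Qed.

Lemma near_off_pole a x : near_pole a x -> off_pole a x.
Proof.
move=> nx; split; first by case: nx.
move=> i; apply: subringM => //; last by case: (near_pole_ratio nx i).
by apply: subringX => //; apply: max_ideal_sub.
Qed.

Lemma near_off_disjoint a x : near_pole a x -> off_pole (~~ a) x -> False.
Proof.
move=> [xa xi] [xb /(_ (pole a)) h]; have := xi _ (pole_neq a) => h'.
apply: (not_max_ideal_inv p0 mp).
have -> : p^-1 = x (pole (~~ a)) 0 / (p ^+ k.+1 * x (pole a) 0) *
    (p ^+ k * (x (pole a) 0 / x (pole (~~ a)) 0)).
  have := expf_neq0 k p0; rewrite exprS; move: (p ^+ k) => P P0.
  by field; rewrite P0 p0 xa xb.
exact: subringM.
Qed.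

(** Entries of [T] relative to [T (pole a) (pole c)] are below [|p|^(-k)], so the factor [p^(k+1)]
    on the other coordinates of [x] leaves only a factor [1 + e] with [e] in the maximal ideal. *)
Lemma near_pole_moved t a c x : near_pole c x ->
  off_pole a ((if t then S else invmx S) *m x).
Proof.
move=> nx; set T := if t then _ else _; have xc : x (pole c) 0 != 0 by case: nx.
have [Tac _] := dom t a c (pole a) (pole c); rewrite -/T in Tac.
have TO i j : m (p ^+ k * (T i j / T (pole a) (pole c))) by case: (dom t a c i j).
pose e := \sum_(j | j != pole c) (T (pole a) j / T (pole a) (pole c)) * (x j 0 / x (pole c) 0).
have me : m e.
  apply: max_ideal_sum => // j jc; have [_ /(_ jc)[o Oo ->]] := near_pole_ratio nx j.
  rewrite exprSr (_ : _ * _ = p ^+ k * (T (pole a) j / T (pole a) (pole c)) * (p * o)); last by ring.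
  by apply: max_idealM => //; apply: subringM => //; apply: max_ideal_sub.
have Tx i : (T *m x) i 0 = T (pole a) (pole c) * x (pole c) 0 *
    \sum_j (T i j / T (pole a) (pole c)) * (x j 0 / x (pole c) 0).
  by rewrite mxE mulr_sumr; apply: eq_bigr => j _; field; rewrite Tac xc.
have [e0 Oe] := max_ideal_unit1 Oval me.
have Txa : (T *m x) (pole a) 0 = T (pole a) (pole c) * x (pole c) 0 * (1 + e).
  by rewrite Tx (bigD1 (pole c)) //= !mulfV // mulr1.
split; first by rewrite Txa !mulf_neq0.
move=> i; rewrite Txa Tx; set s := \sum_j _.
have -> : p ^+ k * (T (pole a) (pole c) * x (pole c) 0 * s /
    (T (pole a) (pole c) * x (pole c) 0 * (1 + e))) = (1 + e)^-1 * (p ^+ k * s).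
  by move: (p ^+ k) => P; field; rewrite Tac xc e0.
apply: subringM => //; rewrite mulr_sumr; apply: subring_sum => // j _.
rewrite mulrA; apply: subringM => //; first exact: max_ideal_sub.
by case: (near_pole_ratio nx j).
Qed.

Variable N : nat.
Hypothesis contract : forall a i, i != pole a ->
  O ((dsign a i / dsign a (pole a)) ^+ N * (p ^+ k * p ^+ k.+1)^-1).

Lemma off_pole_contracted a x : off_pole a x -> near_pole a (dmx a N *m x).
Proof.
move=> [xa xi].
have Dx i : (dmx a N *m x) i 0 = dsign a i ^+ N * x i 0.
  by rewrite mul_diag_mx !mxE.
have da : dsign a (pole a) ^+ N != 0 by rewrite expf_neq0 // dsign_neq0.
split; first by rewrite Dx mulf_neq0.
move=> i ia; rewrite !Dx.
have -> : dsign a i ^+ N * x i 0 / (p ^+ k.+1 * (dsign a (pole a) ^+ N * x (pole a) 0)) =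
   (dsign a i / dsign a (pole a)) ^+ N * (p ^+ k * p ^+ k.+1)^-1 *
   (p ^+ k * (x i 0 / x (pole a) 0)).
  rewrite exprMn exprVn; have := expf_neq0 k p0; have := expf_neq0 k.+1 p0.
  move: (p ^+ k) (p ^+ k.+1) (dsign a i ^+ N) (dsign a (pole a) ^+ N) da => A B C E E0 B0 A0.
  by field; rewrite A0 B0 E0 xa.
by apply: subringM => //; apply: contract.
Qed.

Definition near_letter (l : bool * bool) (x : 'cV[K]_n.+2) : Prop :=
  near_pole l.2 (side (invmx S) l.1 *m x).

Lemma side_Kinv t (x : 'cV[K]_n.+2) : side (invmx S) t *m (side S t *m x) = x.
Proof. by rewrite mulmxA; case: t; rewrite /= ?mulVmx // !mul1mx. Qed.

(** The excluded case is that [l] is the inverse of the letter [(t, a)], the only cancellation a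
    reduced word forbids. *)
Lemma near_letter_off l t a x : near_letter l x -> (l.1 == t) && (l.2 != a) = false ->
  off_pole a (side (invmx S) t *m x).
Proof.
case: l => u c; rewrite /near_letter /= => nx; have [<-|ut] := eqVneq u t => /=.
  by move/negbFE/eqP <-; apply: near_off_pole.
move=> _; case: u t ut nx => [] [] //= _ nx; rewrite mul1mx in nx *.
  by rewrite -(mulKVmx uS x); exact: (@near_pole_moved true _ _ _ nx).
exact: (@near_pole_moved false _ _ _ nx).
Qed.

Lemma near_letter_step l l' x : near_letter l' x -> ~~ ((l.1 == l'.1) && (l.2 != l'.2)) ->
  near_letter l (letter_mx S N l *m x).
Proof.
move=> nx ll'; rewrite /near_letter /letter_mx -!mulmxA side_Kinv.
apply: off_pole_contracted; apply: near_letter_off nx _.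
by rewrite [l'.1 == _]eq_sym [l'.2 == _]eq_sym; apply: negbTE.
Qed.

Lemma near_letter_word l w l' x : reduced (rcons (l :: w) l') -> near_letter l' x ->
  near_letter l (word_mx S N (l :: w) *m x).
Proof.
elim: w l => [|l2 w IHw] l; rewrite /= -?/(word_mx S N _).
  by rewrite mulmx1 andbT => ll' nx; apply: near_letter_step nx _.
move=> /andP[ll2 red] nx; rewrite -mulmxA.
exact: near_letter_step (IHw _ red nx) ll2.
Qed.

Lemma near_letter_disjoint l l' x : near_letter l x -> near_letter l' x -> l.2 != l'.2 -> False.
Proof.
move=> nx nx' ll'; apply: (near_off_disjoint nx).
apply: (near_letter_off nx'); rewrite (_ : ~~ l.2 = l'.2) ?eqxx ?andbF //.
by move: ll'; case: l.2 l'.2 => [] [].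
Qed.

Lemma near_letter_exists l : exists x, near_letter l x.
Proof.
exists (side S l.1 *m delta_mx (pole l.2) 0); rewrite /near_letter side_Kinv; split.
  by rewrite mxE !eqxx oner_eq0.
by move=> i il; rewrite mxE (negPf il) /= mul0r; apply: subring0.
Qed.

(** The appended letter uses the other generator, so nothing cancels. Its sign is opposite to that
    of the first letter, so the neighborhoods of both are disjoint: a point near it cannot be fixed
    by the word. *)
Lemma reduced_rcons l w : reduced (rcons (l :: w) (~~ (last l w).1, ~~ l.2)) = reduced (l :: w).
Proof.
rewrite -[X in (_, X)]/(~~ l.2); move: (~~ l.2) => a.
elim: w l => [|l2 w IHw] l /=; last by congr (_ && _); exact: IHw.
by rewrite andbT; case: l => [[] []].
Qed.

Lemma word_mx_neq1 w : w != [::] -> reduced w -> word_mx S N w != 1%:M.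
Proof.
case: w => // l w _ red; apply/eqP => w1; rewrite -reduced_rcons in red.
have [x nx] := near_letter_exists (~~ (last l w).1, ~~ l.2).
have := near_letter_word red nx; rewrite w1 mul1mx => nx'.
by apply: near_letter_disjoint nx' nx _; case: l.2.
Qed.

End Attraction.

Lemma ping_pong (S : 'M[K]_n.+2) : generic S ->
  eventually (fun N => forall w, w != [::] -> reduced w -> word_mx S N w != 1%:M).
Proof.
(* A convenient nonzero element of the maximal ideal, serving as the unit of smallness. *)
move=> [uS gS]; pose p := d ord_max / d ord0.
have mp : m p by apply: dmax.
have p0 : p != 0 by rewrite mulf_neq0 ?invr_eq0.
have ev (t : bool * bool * bool * 'I_n.+2 * 'I_n.+2) : eventually (fun k =>
    let T := if t.1.1.1.1 then S else invmx S in
    m (p ^+ k * (T t.1.2 t.2 / T (pole t.1.1.1.2) (pole t.1.1.2)))).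
  exact: rank_one_eventually.
have [k /(_ k (leqnn k)) evk] := eventually_forall ev.
have dom t a c i j : let T := if t then S else invmx S in
    T (pole a) (pole c) != 0 /\ m (p ^+ k * (T i j / T (pole a) (pole c))).
  split; last exact: (evk (t, a, c, i, j)).
  by case: (t); case: (gS a c).
have ev2 (t : bool * 'I_n.+2) : eventually (fun N => t.2 != pole t.1 ->
    O ((dsign t.1 t.2 / dsign t.1 (pole t.1)) ^+ N * (p ^+ k * p ^+ k.+1)^-1)).
  have [|h] := eqVneq t.2 (pole t.1); first by exists 0%N.
  apply: (eventually_mono (rank_one_eventually (p ^+ k * p ^+ k.+1)^-1 O1 (dsign_dom h))) => N mN _.
  exact: max_ideal_sub mN.
apply: (eventually_mono (eventually_forall ev2)) => N evN w w0 red.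
by apply: (word_mx_neq1 uS p0 mp dom) => // a i; apply: (evN (a, i)).
Qed.

End PingPong.

(** * Subgroups and free groups on two generators *)

Section Subgroups.
Variable D : unitRingType.
Implicit Types (H G S : D -> Prop).

Lemma units_subgroup : is_subgroup (fun x : D => x \is a GRing.unit).
Proof.
split=> [||x y ux uy|x ux]; rewrite ?unitr1 ?unitrV //.
by rewrite unitrMl.
Qed.

Lemma centralizer_subgroup (a : D) :
  is_subgroup (fun x => x \is a GRing.unit /\ x * a = a * x).
Proof.
split=> [|x []|x y [ux cx] [uy cy]|x [ux cx]] //.
- by rewrite unitr1 mul1r mulr1.
- by rewrite unitrMl // -mulrA cy mulrA cx mulrA.
- rewrite unitrV; split=> //; apply: (mulrI ux); rewrite mulVKr //.
  by rewrite mulrA cx mulrK // -cx.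
Qed.

Lemma gen_subset S x : S x -> gen S x.
Proof. by move=> Sx K _; apply. Qed.

Lemma gen_min S H : is_subgroup H -> sub S H -> sub (gen S) H.
Proof. by move=> Hg SH x; apply. Qed.

Lemma gen_subgroup S : (forall x, S x -> x \is a GRing.unit) -> is_subgroup (gen S).
Proof.
move=> Su; split.
- by move=> K [].
- exact: (gen_min units_subgroup Su).
- by move=> x y Gx Gy K Kg SK; case: (Kg) => _ _ KM _; apply: KM; [apply: (Gx K) | apply: (Gy K)].
- by move=> x Gx K Kg SK; case: (Kg) => _ _ _ KV; apply: KV; apply: (Gx K).
Qed.

Lemma free_of_reduced_words (G : D -> Prop) (a : bool -> D) : is_subgroup G ->
  (forall t, G (a t)) ->
  (forall w, w != [::] -> reduced w ->
     eval_word [seq (a l.1, l.2) | l <- w] != 1) ->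
  exists H, is_subgroup H /\ sub H G /\ is_free H /\ ~ cyclic H.
Proof.
move=> Gg Ga free; have [_ Gu _ _] := Gg.
pose S z := z = a false \/ z = a true.
have au t : a t \is a GRing.unit by apply: Gu.
have Su x : S x -> x \is a GRing.unit by case=> ->.
have aneq : a false != a true.
  have := free [:: (false, true); (true, false)] isT isT.
  by apply: contra_neq => /= ->; rewrite mulr1 mulrV.
exists (gen S); split; first exact: gen_subgroup.
split; first by apply: (gen_min Gg) => x [] ->.
split.
  exists S; split; first by move=> x; apply: gen_subset.
  split=> // w w0 red wS.
  pose tag (l : D * bool) := (l.1 == a true, l.2).
  have tagK l : l \in w -> (a (tag l).1, (tag l).2) = l.
    by case: l => z s /wS[] /= ->; rewrite /tag /= ?eqxx // (negPf aneq).
  have <- : [seq (a l.1, l.2) | l <- [seq tag l | l <- w]] = w.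
    by rewrite -map_comp -[RHS]map_id; apply/eq_in_map => l /tagK.
  apply: free; first by case: (w) w0.
  elim: w red tagK {w0 wS} => // l [|l' w] IHw //= /andP[ll' red] tagK.
  apply/andP; split; last by apply: IHw => // z zw; apply: tagK; rewrite inE zw orbT.
  apply: contra ll' => /andP[e ->]; rewrite andbT; apply/eqP.
  have := tagK l; have := tagK l'; rewrite !inE !eqxx /= !orbT => /(_ isT) <- /(_ isT) <-.
  by rewrite /tag /= (eqP e).
move=> [x Hx].
have ux : x \is a GRing.unit.
  have gx : gen S x by apply: (proj2 (Hx x)); apply: gen_subset.
  exact: (gen_min units_subgroup Su gx).
have comm_x y : gen S y -> y * x = x * y.
  move/Hx => gy; have [] // : y \is a GRing.unit /\ y * x = x * y.
  by apply: (gen_min (centralizer_subgroup x)) gy => _ ->.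
have : a true * a false = a false * a true.
  have /Hx gt : gen S (a true) by apply: gen_subset; right.
  have [] // : a true \is a GRing.unit /\ a true * a false = a false * a true.
  apply: (gen_min (centralizer_subgroup (a false))) gt => _ ->; split=> //.
  by rewrite comm_x //; apply: gen_subset; left.
(* The commutator of the two generators is a nontrivial reduced word, so the group is not cyclic. *)
have := free [:: (true, true); (false, true); (true, false); (false, false)] isT isT.
move=> + c; apply/negP; rewrite negbK /= mulr1 !mulrA c mulrK // mulrV //.
Qed.
End Subgroups.

(** * Cyclic algebras *)

Section CyclicAlgebra.
Variables (D : unitRingType) (K : fieldType) (iota : {rmorphism K -> D}) (sigma : {rmorphism K -> K}).
Variables (h : D) (n : nat) (b th : K).
Local Notation q := n.+2.
Local Notation s := (morph_iter sigma).
Hypotheses (divD : is_division_ring D) (uh : h \is a GRing.unit)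
  (iotah : forall y, iota y * h = h * iota (sigma y)) (hq : h ^+ q = iota b)
  (th_inj : {in gtn q &, injective (fun i => s i th)}).

Lemma iotahX y j : iota y * h ^+ j = h ^+ j * iota (s j y).
Proof.
elim: j y => [|j IHj] y; first by rewrite expr0 mulr1 mul1r.
by rewrite exprS mulrA iotah -mulrA IHj mulrA morph_iterSr.
Qed.

Lemma iota_inj : injective iota.
Proof. exact: fmorph_inj. Qed.

(** Left multiplication by [iota th] minus right multiplication by [iota c] scales the component of
    [h ^+ i] by [s i th - c]. Letting [c] run over the other conjugates of [th] isolates one
    component. *)
Lemma powers_independent (y : 'I_q -> K) :
  \sum_(i < q) h ^+ i * iota (y i) = 0 -> forall i, y i = 0.
Proof.
move=> y0 i; have prod0 (r : seq K) : \sum_(i < q) h ^+ i * iota (\prod_(c <- r) (s i th - c) * y i) = 0.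
  elim: r => [|c r IHr].
    by under eq_bigr do rewrite big_nil mul1r.
  have := congr1 (fun z => iota th * z - z * iota c) IHr; rewrite mulr0 mul0r subr0 => e; apply: etrans e.
  rewrite mulr_sumr mulr_suml -sumrB; apply: eq_bigr => j _.
  rewrite mulrA iotahX -!mulrA -mulrBr -!rmorphM -rmorphB big_cons; congr (_ * iota _).
  by rewrite -mulrA mulrBl [_ * c]mulrC.
pose r := [seq s (val j) th | j <- rem i (enum 'I_q)].
have := prod0 r.
have ri j : (j \in rem i (enum 'I_q)) = (j != i) by rewrite mem_rem_uniq ?enum_uniq // inE mem_enum andbT.
rewrite (bigD1 i) //= [X in _ + X]big1 => [|j ji]; last first.
  have -> : \prod_(c <- r) (s j th - c) = 0; last by rewrite mul0r rmorph0 mulr0.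
  by apply/eqP; rewrite big_map prodf_seq_eq0; apply/hasP; exists j; rewrite ?ri // subrr eqxx.
rewrite addr0 => /eqP; rewrite -(mulr0 (h ^+ i)) => /eqP /(mulrI (unitrX _ uh)) /eqP.
rewrite -(rmorph0 iota) => /eqP /iota_inj /eqP; rewrite mulf_eq0 => /orP[|/eqP //].
rewrite big_map prodf_seq_eq0 => /hasP[j]; rewrite ri /= subr_eq0 => ji /eqP /th_inj e.
by rewrite -(inj_eq val_inj) /= -e ?eqxx ?inE ?ltn_ord in ji.
Qed.

(* [X] is the matrix of left multiplication by [x] on the right [K]-space with
basis [1, h, ..., h^(q-1)]. *)
Definition repr (x : D) (X : 'M[K]_q) : Prop :=
  forall j : 'I_q, x * h ^+ j = \sum_(i < q) h ^+ i * iota (X i j).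

Lemma repr1 : repr 1 1%:M.
Proof.
move=> j; rewrite mul1r (bigD1 j) //= mxE eqxx rmorph1 mulr1 big1 ?addr0 // => i ij.
by rewrite mxE (negPf ij) rmorph0 mulr0.
Qed.

Lemma repr_col x X (v : 'I_q -> K) : repr x X ->
  x * (\sum_(j < q) h ^+ j * iota (v j)) = \sum_(i < q) h ^+ i * iota (\sum_j X i j * v j).
Proof.
move=> xX; rewrite mulr_sumr.
under eq_bigr do rewrite mulrA xX mulr_suml.
rewrite exchange_big; apply: eq_bigr => i _; rewrite rmorph_sum mulr_sumr /=.
by apply: eq_bigr => j _; rewrite rmorphM mulrA.
Qed.

Lemma reprM x y X Y : repr x X -> repr y Y -> repr (x * y) (X *m Y).
Proof.
move=> xX yY j; rewrite -mulrA yY (repr_col _ xX).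
by apply: eq_bigr => i _; rewrite mxE.
Qed.

Lemma reprD x y X Y : repr x X -> repr y Y -> repr (x + y) (X + Y).
Proof.
move=> xX yY j; rewrite mulrDl xX yY -big_split; apply: eq_bigr => i _ /=.
by rewrite mxE rmorphD mulrDr.
Qed.

Lemma reprN x X : repr x X -> repr (- x) (- X).
Proof.
move=> xX j; rewrite mulNr xX -sumrN; apply: eq_bigr => i _ /=.
by rewrite mxE rmorphN mulrN.
Qed.

Lemma repr_inj x X Y : repr x X -> repr x Y -> X = Y.
Proof.
move=> xX xY; apply/matrixP => i j; apply/eqP; rewrite -subr_eq0; apply/eqP.
apply: (powers_independent (y := fun i => X i j - Y i j)).
under eq_bigr do rewrite rmorphB mulrBr; rewrite sumrB -xX -xY subrr //.
Qed.

Lemma repr_first x X : repr x X -> x = \sum_(i < q) h ^+ i * iota (X i ord0).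
Proof. by move=> /(_ ord0); rewrite expr0 mulr1. Qed.

Lemma reprV x X : x != 0 -> repr x X -> X \in unitmx /\ repr x^-1 (invmx X).
Proof.
move=> x0 xX; have ux := divD x0.
have uX : X \in unitmx.
  rewrite -unitmx_tr -row_free_unit -kermx_eq0; apply/rowV0P => v /sub_kermxP vX.
  apply/rowP => i; rewrite mxE; apply: (powers_independent (y := fun i => v 0 i)).
  apply: (mulrI ux); rewrite mulr0 (repr_col _ xX) big1 // => k _.
  rewrite (_ : \sum_j _ = 0) ?rmorph0 ?mulr0 //.
  have := congr1 (fun w : 'rV_q => w 0 k) vX; rewrite !mxE => e; apply: etrans e.
  by apply: eq_bigr => j _; rewrite mxE mulrC.
split=> // j; apply: (mulrI ux); rewrite mulVKr // (repr_col _ xX) -[LHS]mul1r repr1.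
apply: eq_bigr => i _; rewrite -(mulmxV uX) mxE //.
Qed.

Lemma repr_iota y : repr (iota y) (diag_mx (\row_j s j y)).
Proof.
move=> j; rewrite iotahX (bigD1 j) //= !mxE eqxx mulr1n big1 ?addr0 // => i ij.
by rewrite !mxE (negPf ij) mulr0n rmorph0 mulr0.
Qed.

Lemma repr_shift : repr h (shift_mx n b).
Proof.
move=> j; rewrite -exprS; have [->|jn] := eqVneq j ord_max.
  rewrite (bigD1 ord0) //= !mxE /= eqxx expr0 mul1r hq big1 ?addr0 // => i i0.
  rewrite !mxE (negPf (i0 : i != 0%N :> nat)) ltn_eqF //= ?rmorph0 ?mulr0 //.
have jn' : (j.+1 < n.+2)%N by rewrite ltn_neqAle ltn_ord andbT eqSS.
rewrite (bigD1 (Ordinal jn')) //= !mxE /= eqxx rmorph1 mulr1 big1 ?addr0 // => i ij.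
rewrite !mxE (negPf jn) (_ : (i == j.+1 :> nat) = false) ?if_same ?rmorph0 ?mulr0 //.
by apply/negbTE.
Qed.

Lemma repr_dmx g a N : g != 0 ->
  repr ((if a then iota g else (iota g)^-1) ^+ N) (dmx (fun i : 'I_q => s i g) a N).
Proof.
move=> g0.
have -> : (if a then iota g else (iota g)^-1) ^+ N = iota ((if a then g else g^-1) ^+ N).
  by rewrite rmorphXn; case: a => //; rewrite fmorphV.
have := repr_iota ((if a then g else g^-1) ^+ N); congr (repr _ (diag_mx _)).
by apply/rowP => i; rewrite !mxE rmorphXn /= /dsign; case: a => //; rewrite fmorphV.
Qed.

End CyclicAlgebra.

(** * Descent along an almost subnormal chain *)

Section AlmostSubnormal.
Variable D : unitRingType.
Implicit Types (H L : D -> Prop).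

Lemma subgroupX H x k : is_subgroup H -> H x -> H (x ^+ k).
Proof. by move=> [H1 _ HM _] Hx; elim: k => // k IHk; rewrite exprS; apply: HM. Qed.

Lemma almost_subnormal_subgroup K H : is_subgroup K -> almost_subnormal K H -> is_subgroup H.
Proof. by move=> Kg; case. Qed.

(** Two of the first powers of [x] share a coset, so an exponent bounded by the number of
    representatives works; the factorial makes it uniform in [x]. *)
Lemma finite_index_power H L : is_subgroup H -> is_subgroup L -> finite_index_in H L ->
  exists2 M, (0 < M)%N & forall x, L x -> H (x ^+ M).
Proof.
move=> Hg Lg [_ [r [rL cover]]]; have [_ Hu HM HV] := Hg; have [L1 Lu _ _] := Lg.
exists (size r)`!; first exact: fact_gt0.
move=> x Lx; have ux := Lu _ Lx.
have /choice[f fP] : forall i : 'I_(size r).+1, exists k : 'I_(size r), H ((r`_k)^-1 * x ^+ i).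
  move=> i; have [z zr Hz] := cover _ (subgroupX i Lg Lx).
  have zs : (index z r < size r)%N by rewrite index_mem.
  by exists (Ordinal zs); rewrite /= nth_index.
have [i [j ij fij]] : exists i : 'I_(size r).+1, exists2 j : 'I_(size r).+1, (i < j)%N & f i = f j.
  have : ~~ injectiveb f.
    apply/negP => /injectiveP /leq_card; rewrite !card_ord ltnn //.
  case/injectivePn => i [j ij fij].
  by case: (ltngtP i j) ij => [lt|lt|/val_inj ->]; rewrite ?eqxx //; [exists i, j | exists j, i].
have Hij : H (x ^+ (j - i)).
  have uz : r`_(f i) \is a GRing.unit by apply: Lu; apply: rL; apply: mem_nth.
  have := HM _ _ (HV _ (fP i)) (fP j); rewrite -fij invrM ?unitrX ?unitrV // invrK -!mulrA mulVKr //.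
  by rewrite -{1}(subnKC (ltnW ij)) exprD mulKr // unitrX.
have /dvdnP[c ->] : (j - i %| (size r)`!)%N.
  by apply: dvdn_fact; rewrite subn_gt0 ij /= (leq_trans (leq_subr _ _)) // -ltnS.
by rewrite mulnC exprM; apply: subgroupX.
Qed.
End AlmostSubnormal.

Local Arguments morph_iter : simpl never.

Section CyclicAlgebraFree.
Variables (D : unitRingType) (K : fieldType) (iota : {rmorphism K -> D}) (sigma : {rmorphism K -> K}).
Variables (h : D) (n : nat) (b th : K).
Local Notation q := n.+2.
Local Notation s := (morph_iter sigma).
Local Notation repr := (repr iota h).
Local Notation units := (fun x : D => x \is a GRing.unit).
Hypotheses (divD : is_division_ring D) (uh : h \is a GRing.unit)
  (iotah : forall y, iota y * h = h * iota (sigma y)) (hq : h ^+ q = iota b)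
  (th_inj : {in gtn q &, injective (fun i => s i th)})
  (q_pr : prime q) (sigmaq : forall x, s q x = x).

Definition cyclic_norm y := \prod_(i < q) s i y.

Lemma cyclic_normM x y : cyclic_norm (x * y) = cyclic_norm x * cyclic_norm y.
Proof. by rewrite -big_split; apply: eq_bigr => i _; rewrite rmorphM. Qed.

Lemma cyclic_norm1 : cyclic_norm 1 = 1.
Proof. by rewrite /cyclic_norm big1 // => i _; rewrite rmorph1. Qed.

Lemma cyclic_normX x k : cyclic_norm (x ^+ k) = cyclic_norm x ^+ k.
Proof.
by elim: k => [|k IHk]; rewrite ?expr0 ?cyclic_norm1 // !exprS cyclic_normM IHk.
Qed.

Lemma cyclic_normV x : cyclic_norm x^-1 = (cyclic_norm x)^-1.
Proof. by rewrite /cyclic_norm -prodfV; apply: eq_bigr => i _; rewrite fmorphV. Qed.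

Lemma cyclic_norm_shift y : \prod_(i < q) s i.+1 y = cyclic_norm y.
Proof.
have [->|y0] := eqVneq y 0.
  by rewrite /cyclic_norm !big_ord_recl !rmorph0 !mul0r.
have : \prod_(i < q.+1) s i y = cyclic_norm y * y by rewrite big_ord_recr /= sigmaq.
by rewrite big_ord_recl /= mulrC => /(mulIf y0).
Qed.

Lemma cyclic_norm_iter y i : cyclic_norm (s i y) = cyclic_norm y.
Proof.
elim: i => // i <-; rewrite -[in RHS]cyclic_norm_shift; apply: eq_bigr => j _.
by rewrite -!morph_iterD addnS addSn.
Qed.

(* In the group ring of [sigma] this is [(1 - sigma) (sum_i i sigma^i) = Nm - q]. *)
Lemma norm_one_power_quotient y : y != 0 -> cyclic_norm y = 1 ->
  exists z, [/\ z != 0, cyclic_norm z = 1 & z / sigma z = y ^+ q].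
Proof.
move=> y0 Ny; pose w := y^-1; have w0 : w != 0 by rewrite invr_eq0.
have Nw : cyclic_norm w = 1 by rewrite cyclic_normV Ny invr1.
pose z := \prod_(i < q) s i w ^+ i.
have z0 : z != 0 by apply/prodf_neq0 => i _; rewrite expf_neq0 // fmorph_eq0.
exists z; split=> //.
  rewrite /z (big_morph cyclic_norm cyclic_normM cyclic_norm1) big1 // => i _.
  by rewrite cyclic_normX cyclic_norm_iter Nw expr1n.
have sz : sigma z = z * w ^+ q.
  have <- : \prod_(i < q.+1) s i w ^+ i = z * w ^+ q by rewrite big_ord_recr /= sigmaq.
  rewrite big_ord_recl expr0 mul1r rmorph_prod -[LHS]mul1r -[X in X * _]Nw -cyclic_norm_shift.
  rewrite -big_split; apply: eq_bigr => i _ /=.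
  by rewrite rmorphXn /= -exprS.
rewrite sz invfM mulrA mulfV // mul1r -exprVn invrK //.
Qed.

(** In a normal step, [u = iota z ^+ M] is in the larger group and [h] in the smaller one, so [u *
    h^-1 * u^-1 * h = iota ((z / sigma z) ^+ M)] is in the smaller one; the choice of [z] makes it
    [iota y ^+ (q * M)]. A finite index step costs a further exponent. *)
Lemma almost_subnormal_norm_one G : almost_subnormal units G -> G h ->
  exists2 M, (0 < M)%N & forall y, y != 0 -> cyclic_norm y = 1 -> G (iota y ^+ M).
Proof.
elim=> [_|L H Lsn IHL Hg step Hh].
  by exists 1%N => // y y0 _; rewrite expr1 fmorph_unit.
have Lg := almost_subnormal_subgroup (units_subgroup D) Lsn.
have [_ Hu HM HV] := Hg.
have Lh : L h by case: step => -[HL _]; apply: HL.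
have [M M0 LM] := IHL Lh; case: step => [[HL Hn]|fi]; last first.
  have [M' M'0 HM'] := finite_index_power Hg Lg fi.
  exists (M * M')%N => [|y y0 Ny]; first by rewrite muln_gt0 M0.
  by rewrite exprM; apply: HM'; apply: LM.
exists (q * M)%N; first by rewrite muln_gt0.
move=> y y0 Ny; have [z [z0 Nz zy]] := norm_one_power_quotient y0 Ny.
have [_ Lu _ LV] := Lg; have Lz := LM z z0 Nz; have uz := Lu _ Lz.
have := HM _ _ (Hn _ _ (HV _ Hh) (LV _ Lz)) Hh; congr H.
rewrite invrK -!mulrA; set u := iota z ^+ M in uz *.
have uE : u = iota (z ^+ M) by rewrite rmorphXn.
rewrite uE -fmorphV iotah mulKr // -rmorphM -rmorphXn; congr (iota _).
rewrite exprM -zy fmorphV rmorphXn exprMn exprVn //.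
Qed.

Section Generic.
Variables (O : set K) (g : K).
Hypothesis O1 : rank_one O.
Hypotheses (g0 : g != 0)
  (gmax : forall j, (0 < j < q)%N -> max_ideal O (s j g / g))
  (gmin : forall j, (j < q.-1)%N -> max_ideal O (s q.-1 g / s j g)).
Local Notation d := (fun i : 'I_q => s i g).

Let d0 i : d i != 0. Proof. by rewrite fmorph_eq0. Qed.
Let dmax i : i != ord0 -> max_ideal O (d i / d ord0).
Proof. by move=> i0; apply: gmax; rewrite ltn_ord andbT lt0n. Qed.
Let dmin i : i != ord_max -> max_ideal O (d ord_max / d i).
Proof. by move=> i0; apply: gmin; rewrite ltn_neqAle -ltnS ltn_ord andbT. Qed.

Lemma repr_conj x S N : repr x S -> x != 0 ->
  repr (x^-1 * iota g ^+ N * x) (invmx S *m dmx d true N *m S).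
Proof.
move=> xS x0; have [_ xV] := reprV divD uh iotah th_inj x0 xS.
by apply: reprM => //; apply: reprM => //; have := repr_dmx iotah true N g0.
Qed.

(** The matrix of [1 + h] may have zero entries at the poles, so the chain starts from a power of
    [g] conjugated by it. A conjugate of a high power of [g] by a generic element is again generic
    and lies one step lower. *)
Lemma almost_subnormal_generic G : almost_subnormal units G -> G (iota g) ->
  exists (x : D) (S : 'M[K]_q), [/\ G x, x != 0, repr x S & generic S].
Proof.
have ug : iota g \is a GRing.unit by rewrite fmorph_unit.
have unit_neq0 (z : D) : z \is a GRing.unit -> z != 0.
  by apply: contraTneq => ->; rewrite unitr0.
have b0 : b != 0.
  by rewrite -(fmorph_eq0 iota) -hq; apply: unit_neq0; rewrite unitrX.
elim=> [_|L H Lsn IHL Hg step Hgg].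
  have x0 : 1 + h != 0.
    apply/eqP => h1; have hN1 : h = - 1 by apply/eqP; rewrite -subr_eq0 opprK addrC h1.
    have := iotah th; rewrite hN1 mulrN1 mulN1r => /oppr_inj /(fmorph_inj iota) e.
    by have := th_inj (x := 0%N) (y := 1%N) isT isT e.
  have xU := reprD (@repr1 D K iota h n) (repr_shift hq).
  have [uU _] := reprV divD uh iotah th_inj x0 xU.
  have [N /(_ N (leqnn N)) gN] := generic_base O1 d0 dmax dmin b0 uU.
  exists ((1 + h)^-1 * iota g ^+ N * (1 + h)); eexists; split; [| |exact: repr_conj xU x0|exact: gN].
    by rewrite /= (unitrMl _ (divD x0)) unitrMr ?unitrX // unitrV (divD x0).
  by apply: unit_neq0; rewrite (unitrMl _ (divD x0)) unitrMr ?unitrX // unitrV (divD x0).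
have Lg := almost_subnormal_subgroup (units_subgroup D) Lsn.
have [_ Hu HM HV] := Hg; have [_ Lu LM LV] := Lg.
have Lgg : L (iota g) by case: step => -[HL _]; apply: HL.
have [x [S [Lx x0 xS gS]]] := IHL Lgg.
have [M M0 HMx] : exists2 M, (0 < M)%N & H (x^-1 * iota g ^+ M * x).
  case: step => [[HL Hn]|fi]; first by exists 1%N => //; rewrite expr1; apply: Hn.
  have [M M0 HM'] := finite_index_power Hg Lg fi; exists M => //.
  have <- : (x^-1 * iota g * x) ^+ M = x^-1 * iota g ^+ M * x.
    elim: M {M0 HM'} => [|M IHM]; first by rewrite !expr0 mulr1 mulVr // divD.
    by rewrite !exprS IHM -!mulrA mulVKr // divD.
  exact: (HM' _ (LM _ _ (LM _ _ (LV _ Lx) Lgg) Lx)).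
have [N gN] := generic_step O1 d0 dmax dmin gS.
(* The exponent [M * N] is a multiple of [M], for membership in [H], and at least [N], for
   genericity. *)
have NM : (N <= M * N)%N by rewrite leq_pmull.
exists (x^-1 * iota g ^+ (M * N) * x); eexists; split; [| |exact: repr_conj xS x0|exact: gN].
  have <- : (x^-1 * iota g ^+ M * x) ^+ N = x^-1 * iota g ^+ (M * N) * x.
    rewrite exprM; elim: N {gN NM} => [|N IHN]; first by rewrite !expr0 mulr1 mulVr // divD.
    by rewrite !exprS IHN -!mulrA mulVKr // divD.
  exact: subgroupX.
by apply: unit_neq0; rewrite (unitrMl _ (divD x0)) unitrMr ?unitrX // unitrV (divD x0).
Qed.

Lemma almost_subnormal_hyperbolic_free G : is_subgroup G -> almost_subnormal units G -> G (iota g) ->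
  exists H, is_subgroup H /\ sub H G /\ is_free H /\ ~ Defs.cyclic H.
Proof.
move=> Gg Gsn Ggg; have [x [S [Gx x0 xS gS]]] := almost_subnormal_generic Gsn Ggg.
have [N /(_ N (leqnn N)) pp] := ping_pong O1 d0 dmax dmin gS.
have [uS xV] := reprV divD uh iotah th_inj x0 xS; have ux := divD x0.
have [_ Gu GM GV] := Gg.
pose A := iota g ^+ N; pose a (t : bool) := if t then x * A * x^-1 else A.
have uA : A \is a GRing.unit by rewrite unitrX // fmorph_unit.
have GA : G A by apply: subgroupX.
apply: (@free_of_reduced_words _ G a Gg) => [[]|w w0 red] //.
  exact: (GM _ _ (GM _ _ Gx GA) (GV _ Gx)).
have letterP l : repr (if l.2 then a l.1 else (a l.1)^-1) (letter_mx d S N l).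
  have As e : repr (if e then A else A^-1) (dmx d e N).
    have -> : (if e then A else A^-1) = (if e then iota g else (iota g)^-1) ^+ N.
      by case: e => //; rewrite exprVn.
    exact: repr_dmx.
  case: l => [[] e] /=; rewrite /letter_mx /=; last by rewrite mul1mx mulmx1; apply: As.
  have -> : (if e then x * A * x^-1 else (x * A * x^-1)^-1) = x * (if e then A else A^-1) * x^-1.
    by case: e => //; rewrite invrM ?unitrV ?unitrMl // invrK invrM // mulrA.
  by apply: reprM => //; apply: reprM.
have wordP : repr (eval_word [seq (a l.1, l.2) | l <- w]) (word_mx d S N w).
  elim: (w) => [|l v IHv] /=; first exact: repr1.
  exact: reprM.
apply: contraNneq (pp _ w0 red) => w1; rewrite w1 in wordP.
apply/eqP; exact: (repr_inj uh iotah th_inj wordP (@repr1 D K iota h n)).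
Qed.

End Generic.

Theorem cyclic_algebra_free G : is_subgroup G -> almost_subnormal units G -> G h ->
  (exists x : K, ~ int_algebraic x) \/ (forall e : int, e != 0 -> e%:~R != 0 :> K) ->
  exists H, is_subgroup H /\ sub H G /\ is_free H /\ ~ Defs.cyclic H.
Proof.
move=> Gg Gsn Gh big.
have th_moved : sigma th != th.
  by apply/eqP => e; have := th_inj (x := 1%N) (y := 0%N) isT isT e.
have [O O1 [y y0 my]] := exists_unbalanced_valuation th_moved big.
have [g [g0 Ng gmax gmin]] := exists_hyperbolic_norm_one q_pr sigmaq O1 y0 my.
have [[//|M] _ GM] := almost_subnormal_norm_one Gsn Gh.
have Oval := proj1 O1.
apply: (@almost_subnormal_hyperbolic_free O (g ^+ M.+1)) => //.
- by rewrite expf_neq0.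
- by move=> j jq; rewrite rmorphXn /= -expr_div_n; apply: max_idealX => //; apply: gmax.
- by move=> j jq; rewrite !rmorphXn /= -expr_div_n; apply: max_idealX => //; apply: gmin.
- by rewrite rmorphXn; apply: GM.
Qed.

End CyclicAlgebraFree.

(** * Exclusion of locally finite fields *)

Lemma root_sequence_repeats (K : fieldType) (p : {poly K}) (u : nat -> K) : p != 0 ->
  (forall i, root p (u i)) -> exists i j, (i < j)%N /\ u i = u j.
Proof.
move=> p0 pu; apply: contrapT => nrep.
have : (size [seq u i | i <- iota 0 (size p)] < size p)%N.
  apply: max_poly_roots p0 _ _; first by apply/allP => _ /mapP[i _ ->].
  rewrite map_inj_uniq ?iota_uniq // => i j uij.
  by case: (ltngtP i j) => // ij; case: nrep; [exists i, j | exists j, i].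
by rewrite size_map size_iota ltnn.
Qed.

Lemma poly_roots_finite (K : fieldType) (p : {poly K}) : p != 0 ->
  exists r : seq K, forall x, root p x -> x \in r.
Proof.
move=> p0; have [//|[r [ur pr sr]]] : (exists r : seq K, forall x, root p x -> x \in r) \/
    exists r, [/\ uniq r, all (root p) r & size r = size p].
  elim: (size p) => [|n [IHn|[r [ur pr <-]]]]; [by right; exists [::] | by left |].
  have [|nr] := pselect (forall x, root p x -> x \in r); first by left; exists r.
  have [x px xr] : exists2 x, root p x & x \notin r.
    by apply: contrapT => nx; apply: nr => x px; apply: contrapT => /negP xr; apply: nx; exists x.
  by right; exists (x :: r); rewrite /= xr px.
by have := max_poly_roots p0 pr ur; rewrite sr ltnn.
Qed.

(** Frobenius fixes integer polynomials, so the iterates of an integral multiple of [x] stay among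
    finitely many roots; injectivity makes the orbit purely periodic. *)
Lemma frobenius_periodic (K : fieldType) p (charp : p \in [pchar K]) (x : K) : int_algebraic x ->
  exists2 k, (0 < k)%N & morph_iter (pFrobenius_aut charp) k x = x.
Proof.
move=> [d d0 [f mon_f fx]]; set y := d%:~R * x in fx.
pose phi := morph_iter (pFrobenius_aut charp).
have phi_root i : root (map_poly intr f) (phi i y).
  elim: i => // i IHi; rewrite /phi morph_iterS.
  have -> : map_poly intr f = map_poly (pFrobenius_aut charp) (map_poly intr f) :> {poly K}.
    by rewrite -map_poly_comp; apply: eq_map_poly => c /=; rewrite rmorph_int.
  exact: rmorph_root.
have f0 : map_poly intr f != 0 :> {poly K} by rewrite monic_neq0 // monic_map.
have [i [j [ij]]] := root_sequence_repeats f0 phi_root.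
rewrite -(subnKC (ltnW ij)) /phi morph_iterD => /fmorph_inj e.
exists (j - i)%N; first by rewrite subn_gt0.
by apply: (mulfI d0); rewrite -[RHS]/y [RHS]e rmorphM rmorph_int.
Qed.

Lemma morph_iter_periodic (K : fieldType) (phi : {rmorphism K -> K}) k l x :
  morph_iter phi k x = x -> morph_iter phi (l * k) x = x.
Proof. by move=> kx; elim: l => // l IHl; rewrite mulSn morph_iterD IHl. Qed.

Lemma frobenius_fixed_finite (K : fieldType) p (charp : p \in [pchar K]) k : (0 < k)%N ->
  exists r : seq K, forall x, morph_iter (pFrobenius_aut charp) k x = x -> x \in r.
Proof.
move=> k0; have p1 := prime_gt1 (pcharf_prime charp).
have FX x : morph_iter (pFrobenius_aut charp) k x = x ^+ (p ^ k).
  elim: k {k0} => [|k IHk]; first by rewrite expr1.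
  by rewrite morph_iterS IHk /= pFrobenius_autE -exprM expnSr.
have P0 : 'X^(p ^ k) - 'X != 0 :> {poly K}.
  rewrite -size_poly_eq0 size_polyDl ?size_polyXn // size_polyN size_polyX ltnS.
  by apply: leq_trans p1 _; rewrite -{1}(expn1 p) leq_exp2l // prime_gt1 // (pcharf_prime charp).
have [r rP] := poly_roots_finite P0; exists r => x fx; apply: rP.
by rewrite /root !hornerE -FX fx subrr.
Qed.

Section NotLocallyFinite.
Variables (D : unitRingType) (K : fieldType) (iota : {rmorphism K -> D}) (sigma : {rmorphism K -> K}).
Variables (h : D) (n : nat) (b th : K).
Local Notation q := n.+2.
Local Notation s := (morph_iter sigma).
Local Notation repr := (repr iota h).
Hypotheses (divD : is_division_ring D) (uh : h \is a GRing.unit)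
  (iotah : forall y, iota y * h = h * iota (sigma y)) (hq : h ^+ q = iota b)
  (th_inj : {in gtn q &, injective (fun i => s i th)}).

(** Otherwise a Frobenius power fixes both [th] and [b]. Elements whose matrix is fixed by it form a
    division ring, finite because the first column determines the element. It contains [h] and
    [iota th], which do not commute, contrary to Wedderburn. *)
Lemma cyclic_algebra_not_locally_finite :
  (exists x : K, ~ int_algebraic x) \/ (forall e : int, e != 0 -> e%:~R != 0 :> K).
Proof.
apply: contrapT => /not_orP[nalg nchar0].
have alg (x : K) : int_algebraic x by apply: contrapT => nx; apply: nalg; exists x.
have [p charp] : exists p, p \in [pchar K].
  have [e e0 eK] : exists2 e : int, e != 0 & e%:~R = 0 :> K.
    apply: contrapT => ne; apply: nchar0 => e e0; apply/eqP => eK.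
    by apply: ne; exists e.
  have [||p charp] := @natf0_pchar K `|e|%N; [by rewrite absz_gt0 | | by exists p].
  by case: e {e0} eK => k /=; [move/eqP | rewrite NegzE mulrNz => /eqP; rewrite oppr_eq0].
pose phi := morph_iter (pFrobenius_aut charp).
have [k [k0 kth kb]] : exists k, [/\ (0 < k)%N, phi k th = th & phi k b = b].
  have [k1 k10 e1] := frobenius_periodic charp (alg th).
  have [k2 k20 e2] := frobenius_periodic charp (alg b).
  exists (k1 * k2)%N; rewrite muln_gt0 k10 k20; split=> //; last exact: morph_iter_periodic.
  by rewrite mulnC; apply: morph_iter_periodic.
have [r rP] := frobenius_fixed_finite charp k0.
pose P x := exists2 X : 'M[K]_q, repr x X & map_mx (phi k) X = X.
have Pdiv : divring_subset P.
  split.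
  - by exists 1%:M; [apply: repr1 | rewrite map_mx1].
  - move=> x y [X xX fX] [Y yY fY]; exists (X - Y); last by rewrite map_mxB fX fY.
    by apply: reprD => //; apply: reprN.
  - move=> x y [X xX fX] [Y yY fY].
    have [->|y0] := eqVneq y 0.
      exists 0; last by rewrite map_mx0.
      move=> j; rewrite invr0 mulr0 mul0r big1 // => i _.
      by rewrite mxE rmorph0 mulr0.
    have [_ yV] := reprV divD uh iotah th_inj y0 yY.
    by exists (X *m invmx Y); [apply: reprM | rewrite map_mxM map_invmx fX fY].
pose F (f : {ffun 'I_q -> 'I_(size r)}) := \sum_(i < q) h ^+ i * iota r`_(f i).
have Pfin x : P x -> x \in [seq F f | f : {ffun 'I_q -> 'I_(size r)}].
  move=> [X xX fX].
  have Xr i : (index (X i ord0) r < size r)%N.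
    rewrite index_mem; apply: rP; have := congr1 (fun Y : 'M_q => Y i ord0) fX.
    by rewrite mxE.
  apply/mapP; exists [ffun i => Ordinal (Xr i)]; first by rewrite mem_enum.
  rewrite (repr_first xX); apply: eq_bigr => i _; rewrite ffunE /= nth_index //.
  by rewrite -index_mem.
have Ph : P h.
  exists (shift_mx n b); first exact: repr_shift.
  apply/matrixP => i j; rewrite !mxE /phi; case: ifP => _; last by rewrite rmorph_nat.
  by case: ifP => _; rewrite ?rmorph0.
have Pth : P (iota th).
  exists (diag_mx (\row_(j < q) s j th)); first exact: repr_iota.
  apply/matrixP => i j; rewrite !mxE /phi rmorphMn /=; congr (_ *+ _).
  transitivity (s i (phi k th)); last by rewrite kth.
  rewrite /phi; elim: (k) => // l IHl; rewrite !morph_iterS /= !pFrobenius_autE IHl.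
  by rewrite rmorphXn.
have := finite_divring_subset_abelian divD Pdiv Pfin Ph Pth.
rewrite iotah => /(mulrI uh) /(fmorph_inj iota) e.
by have := th_inj (x := 0%N) (y := 1%N) isT isT e.
Qed.
End NotLocallyFinite.

(** * From commuting conjugates to a cyclic algebra *)

Section Centralizers.
Variable D : unitRingType.
Hypothesis divD : is_division_ring D.
Implicit Types X : D -> Prop.

Definition centralizer X : D -> Prop := fun x => forall w, X w -> x * w = w * x.

Lemma centralizer_divring X : divring_subset (centralizer X).
Proof.
split; first by move=> w _; rewrite mul1r mulr1.
- by move=> x y cx cy w Xw; rewrite mulrBl mulrBr cx ?cy.
- move=> x y cx cy w Xw; have [->|y0] := eqVneq y 0; first by rewrite invr0 mulr0 mul0r mulr0.
  have uy := divD y0; rewrite -[LHS]mulrA [RHS]mulrA -cx // -[RHS]mulrA; congr (_ * _).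
  by apply: (mulrI uy); rewrite mulVKr // mulrA cy // mulrK.
Qed.

Lemma bicentralizer_abelian X : Defs.abelian X -> Defs.abelian (centralizer (centralizer X)).
Proof. by move=> Xab x y ccx ccy; apply: ccx => w Xw; apply: ccy => v Xv; apply: Xab. Qed.

Lemma sub_bicentralizer X : sub X (centralizer (centralizer X)).
Proof. by move=> x Xx w cw; rewrite cw. Qed.
End Centralizers.

Section ConjugateOrbit.
Variable D : unitRingType.
Hypotheses (divD : is_division_ring D) (algD : algebraic_over_center D).
Implicit Types (h a : D).

Definition conj_iter h a i : D := h ^- i * a * h ^+ i.

Lemma conj_iter_comm h a i : h \is a GRing.unit ->
  conj_iter h a i = a <-> a * h ^+ i = h ^+ i * a.
Proof.
move=> uh; have uhi := unitrX i uh; rewrite /conj_iter -mulrA; split=> [e|->].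
  by rewrite -{2}e mulVKr.
by rewrite mulKr.
Qed.

Lemma conj_iterD h a i j : h \is a GRing.unit ->
  conj_iter h a (i + j) = conj_iter h (conj_iter h a i) j.
Proof.
by move=> uh; rewrite /conj_iter exprD invrM ?unitrX // !mulrA.
Qed.

Lemma conj_iterM h x y i : h \is a GRing.unit ->
  conj_iter h (x * y) i = conj_iter h x i * conj_iter h y i.
Proof. by move=> uh; rewrite /conj_iter !mulrA mulrK ?unitrX. Qed.

Lemma conj_iter_inj h i : h \is a GRing.unit -> injective (fun x => conj_iter h x i).
Proof.
by move=> uh x y; rewrite /conj_iter => /(mulIr (unitrX i uh)) /(mulrI _); apply; rewrite unitrV unitrX.
Qed.

Lemma conj_iter_pairwise h a : h \is a GRing.unit ->
  (forall i, a * conj_iter h a i = conj_iter h a i * a) ->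
  forall i j, conj_iter h a i * conj_iter h a j = conj_iter h a j * conj_iter h a i.
Proof.
move=> uh ca i j; wlog ij : i j / (i <= j)%N.
  by move=> W; case: (leqP i j) => [|/ltnW] /W.
by rewrite -(subnK ij) conj_iterD // -!conj_iterM // ca.
Qed.

(** All conjugates of [a] are roots of the same polynomial over the center. Because they commute,
    they lie with the center in a commutative double centralizer, where it has finitely many
    roots. *)
Lemma conj_iter_period h a : h \is a GRing.unit ->
  (forall i, a * conj_iter h a i = conj_iter h a i * a) ->
  exists2 k, (0 < k)%N & conj_iter h a k = a.
Proof.
move=> uh ca; pose X z := exists i, z = conj_iter h a i.
have Xab : Defs.abelian X by move=> _ _ [i ->] [j ->]; apply: conj_iter_pairwise.
have [K [iota iotaP]] := subfield_type divD (centralizer_divring divD (centralizer X))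
  (bicentralizer_abelian Xab).
have [p [p0 [pc pa]]] := algD a.
have /choice[f fp] : forall i, exists k, iota k = p`_i.
  by move=> i; apply/iotaP => w _; apply: pc.
have /choice[u ua] : forall i, exists k, iota k = conj_iter h a i.
  by move=> i; apply/iotaP; apply: sub_bicentralizer; exists i.
pose P := \poly_(i < size p) f i.
have pP : p = map_poly iota P.
  apply/polyP => i; rewrite coef_map coef_poly /=; case: ltnP => ip; first by rewrite fp.
  by rewrite rmorph0 nth_default.
have P0 : P != 0 by apply: contra_neq p0 => P0; rewrite pP P0 rmorph0.
have Pu i : root P (u i).
  rewrite -(fmorph_root iota) -pP ua /root; apply/eqP.
  have -> : p.[conj_iter h a i] = conj_iter h p.[a] i.
    rewrite !horner_coef /conj_iter mulr_sumr mulr_suml; apply: eq_bigr => j _.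
    rewrite -/(conj_iter h a i).
    have -> : conj_iter h a i ^+ j = conj_iter h (a ^+ j) i.
      elim: (nat_of_ord j) => [|l IHl]; last by rewrite !exprS conj_iterM // IHl.
      by rewrite !expr0 /conj_iter mulr1 mulVr // unitrX.
    by rewrite /conj_iter !mulrA pc.
  by rewrite pa /conj_iter mulr0 mul0r.
have [i [j [ij /(congr1 iota)]]] := root_sequence_repeats P0 Pu; rewrite !ua.
rewrite -(subnK (ltnW ij)) conj_iterD // -{1}[i]add0n conj_iterD // => /(conj_iter_inj uh).
rewrite [conj_iter h a 0](_ : _ = a) => [e|]; last by rewrite /conj_iter expr0 invr1 mul1r mulr1.
by exists (j - i)%N; rewrite ?subn_gt0.
Qed.

Lemma conj_iter_prime_order h a : h \is a GRing.unit ->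
  (forall i, a * conj_iter h a i = conj_iter h a i * a) -> a * h != h * a ->
  exists k q, [/\ prime q, conj_iter (h ^+ k) a 1 != a & conj_iter (h ^+ k) a q = a].
Proof.
move=> uh ca ah; have [m m0 hm] := conj_iter_period uh ca.
have exm : exists m, (0 < m)%N && (conj_iter h a m == a).
  by exists m; rewrite m0 hm eqxx.
case: (ex_minnP exm) => {m m0 hm} m /andP[m0 /eqP hm] mmin.
have m1 : (1 < m)%N.
  rewrite ltn_neqAle m0 andbT eq_sym; apply: contra ah => /eqP m1.
  by move: hm; rewrite m1 => /(conj_iter_comm _ _ uh); rewrite expr1 => ->.
have conjX k i : conj_iter (h ^+ k) a i = conj_iter h a (k * i).
  by rewrite /conj_iter -exprM.
exists (m %/ pdiv m)%N, (pdiv m); rewrite !conjX muln1 divnK ?pdiv_dvd // pdiv_prime //.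
split=> //; apply/negP => e.
have lt : (m %/ pdiv m < m)%N by rewrite ltn_Pdiv // prime_gt1 // pdiv_prime.
have := mmin (m %/ pdiv m)%N; rewrite e andbT divn_gt0 ?pdiv_gt0 // dvdn_leq ?pdiv_dvd //.
by move=> /(_ isT); rewrite leqNgt lt.
Qed.

Theorem commuting_conjugates_free (G : D -> Prop) h a :
  is_subgroup G -> almost_subnormal (fun x : D => x \is a GRing.unit) G -> G h ->
  (forall i, a * conj_iter h a i = conj_iter h a i * a) -> a * h != h * a ->
  exists H, is_subgroup H /\ sub H G /\ is_free H /\ ~ Defs.cyclic H.
Proof.
move=> Gg Gsn Gh ca ah; have [_ Gu _ _] := Gg.
have [k [q [q_pr]]] := conj_iter_prime_order (Gu _ Gh) ca ah.
have {}ca i : a * conj_iter (h ^+ k) a i = conj_iter (h ^+ k) a i * a.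
  by rewrite /conj_iter -exprM ca.
have {}Gh : G (h ^+ k) by apply: subgroupX.
move: (h ^+ k) Gh ca => {ah}h Gh ca h1 hq; have uh := Gu _ Gh.
have [n qE] : exists n, q = n.+2 by case: q q_pr {hq} => [|[|n]] //; exists n.
rewrite {q}qE in q_pr hq; set q := n.+2 in q_pr hq.
(* Including [h ^+ q] puts it in [K], which yields [b] and makes conjugation by [h ^+ q] trivial on
   [K]. *)
pose X z := (exists i, z = conj_iter h a i) \/ z = h ^+ q.
have haq : a * h ^+ q = h ^+ q * a by apply/(conj_iter_comm _ _ uh).
have hqX i : conj_iter h a i * h ^+ q = h ^+ q * conj_iter h a i.
  by apply/(conj_iter_comm _ _ uh); rewrite -conj_iterD // addnC conj_iterD // hq.
have Xab : Defs.abelian X.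
  move=> _ _ [[i ->]|->] [[j ->]|->] //; first exact: conj_iter_pairwise.
have [K [iota iotaP]] := subfield_type divD (centralizer_divring divD (centralizer X))
  (bicentralizer_abelian Xab).
have /choice[sg sgP] : forall y, exists z, iota z = h^-1 * iota y * h.
  move=> y; apply/iotaP => w cw; have /iotaP cy : exists z, iota z = iota y by exists y.
  (* Conjugation by [h] maps [X] into itself, so [v] centralizes [X] and commutes with [iota y];
     conjugating back gives commutation with [w]. *)
  have [v wv] : exists v, w = conj_iter h v 1.
    by exists (h * w * h^-1); rewrite /conj_iter expr1 !mulrA mulVr // mul1r mulrVK.
  rewrite -[h^-1 * _ * h]/(conj_iter h (iota y) 1) wv -!conj_iterM // cy // => x Xx.
  apply: (conj_iter_inj (i := 1%N) uh); rewrite !conj_iterM // -wv; apply: cw.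
  case: Xx => [[i ->]|->]; [left; exists i.+1 | right].
    by rewrite -conj_iterD // addn1.
  by rewrite /conj_iter -mulrA -exprD addnC exprD mulKr // unitrX.
have sg_zmod : zmod_morphism sg.
  by move=> x y; apply: (fmorph_inj iota); rewrite rmorphB !sgP rmorphB mulrBr mulrBl.
have sg_monoid : monoid_morphism sg.
  split=> [|x y]; apply: (fmorph_inj iota).
    by rewrite sgP rmorph1 mulr1 mulVr.
  by rewrite rmorphM !sgP rmorphM !mulrA mulrK.
pose sigma : {rmorphism K -> K} := HB.pack sg
  (GRing.isZmodMorphism.Build K K sg sg_zmod) (GRing.isMonoidMorphism.Build K K sg sg_monoid).
have iotah y : iota y * h = h * iota (sigma y).
  by rewrite /= sgP -mulrA mulVKr.
have [b hb] : exists b, iota b = h ^+ q.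
  by apply/iotaP; apply: sub_bicentralizer; right.
have [th tha] : exists th, iota th = a.
  apply/iotaP; apply: sub_bicentralizer; left; exists 0%N.
  by rewrite /conj_iter expr0 invr1 mul1r mulr1.
have iotas i y : iota (morph_iter sigma i y) = conj_iter h (iota y) i.
  by rewrite /conj_iter -mulrA (iotahX iotah) mulKr // unitrX.
have b0 : b != 0.
  by rewrite -(fmorph_eq0 iota) hb; apply: contraTneq (unitrX q uh) => ->; rewrite unitr0.
have sigmaq y : morph_iter sigma q y = y.
  apply: (mulfI b0); apply: (fmorph_inj iota); rewrite rmorphM hb -(iotahX iotah) -hb.
  by rewrite -rmorphM mulrC.
have th_inj : {in gtn q &, injective (fun i => morph_iter sigma i th)}.
  move=> i j; rewrite !inE => iq jq.
  wlog ij : i j iq jq / (i <= j)%N.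
    by move=> W; case: (leqP i j) => [|/ltnW] ij e; [apply: W | apply/esym/W].
  move=> e; apply/eqP; rewrite eqn_leq ij /= leqNgt; apply/negP => lt.
  have {}e : morph_iter sigma (j - i) th = th.
    by apply: (fmorph_inj (morph_iter sigma i)); rewrite /= -morph_iterD subnKC.
  have cop : coprime (j - i) q.
    rewrite coprime_sym prime_coprime // gtnNdvd ?subn_gt0 //.
    by apply: leq_ltn_trans (leq_subr _ _) jq.
  have ji0 : (0 < j - i)%N by rewrite subn_gt0.
  have [u v uv _] := egcdnP q ji0.
  case/negP: h1; apply/eqP; rewrite -tha -iotas; congr (iota _).
  have : morph_iter sigma (u * (j - i)) th = th by apply: morph_iter_periodic.
  rewrite uv (eqP cop) addnC morph_iterD.
  by rewrite (morph_iter_periodic _ (sigmaq th)).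
have big := cyclic_algebra_not_locally_finite divD uh iotah (esym hb) th_inj.
exact: (cyclic_algebra_free divD uh iotah (esym hb) th_inj q_pr sigmaq Gg Gsn Gh big).
Qed.
End ConjugateOrbit.

(** * Nilpotent-by-finite subgroups *)

Section CommutingConjugates.
Variable D : unitRingType.
Implicit Types (H N : D -> Prop) (h a x y : D).

(** Only [h] is required to lie in the group; [a] serves merely to generate [K]. *)
Definition commuting_conjugates H : Prop := exists h a,
  [/\ H h, a * h != h * a & forall i, a * conj_iter h a i = conj_iter h a i * a].

Lemma lcs_sub N k : is_subgroup N -> sub (lcs N k) N.
Proof.
move=> Ng; have [_ _ NM NV] := Ng; elim: k => [|k IHk] //=.
apply: gen_min => // _ [x [y [/IHk Nx [Ny ->]]]]; rewrite /commg.
exact: NM _ _ (NM _ _ (NM _ _ (NV _ Nx) (NV _ Ny)) Nx) Ny.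
Qed.

(** Take [x] noncentral in the last noncentral term of the lower central series and [y] not
    commuting with it. Their commutator [z] is central, so the conjugates of [x] by powers of [y]
    are [x * z ^+ i]. *)
Lemma nilpotent_commuting_conjugates N : is_subgroup N -> Defs.nilpotent N ->
  ~ Defs.abelian N -> commuting_conjugates N.
Proof.
move=> Ng [n0 triv] nab; have [_ Nu NM NV] := Ng.
pose C k := forall z y, lcs N k z -> N y -> z * y = y * z.
have exC : exists k, `[< C k >].
  by exists n0; apply/asboolP => z y /triv -> _; rewrite mul1r mulr1.
case: (ex_minnP exC) => [[|k]] /asboolP Ck kmin; first by case: nab => x y; apply: Ck.
have [x [y [Lx Ny xy]]] : exists x y, [/\ lcs N k x, N y & x * y <> y * x].
  apply: contrapT => nxy; suff /kmin : `[< C k >] by rewrite ltnn.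
  by apply/asboolP => x y Lx Ny; apply: contrapT => xy; apply: nxy; exists x, y.
have Nx := lcs_sub Ng Lx; have ux := Nu _ Nx; have uy := Nu _ Ny.
have Lz : lcs N k.+1 (commg x y) by apply: gen_subset; exists x, y.
have zc v : N v -> commg x y * v = v * commg x y by apply: Ck.
have [z zE] : exists z, commg x y = z by exists (commg x y).
rewrite zE {Lz} in zc.
exists y, x; split=> //; first exact/eqP.
have conjE i : conj_iter y x i = x * z ^+ i.
  elim: i => [|i IHi]; first by rewrite /conj_iter !expr0 invr1 mul1r !mulr1.
  rewrite -addn1 conj_iterD // IHi conj_iterM // exprD expr1 mulrA.
  have -> : conj_iter y (z ^+ i) 1 = z ^+ i.
    apply/conj_iter_comm => //; rewrite expr1; elim: i {IHi} => [|i IHi].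
      by rewrite expr0 mul1r mulr1.
    by rewrite exprS -mulrA IHi mulrA zc // mulrA.
  have -> : conj_iter y x 1 = x * z by rewrite /conj_iter -zE /commg !mulrA mulrV // mul1r !expr1.
  rewrite -!mulrA; congr (_ * _); rewrite -exprS -exprSr //.
move=> i; rewrite conjE -[RHS]mulrA; congr (_ * _); elim: i => [|i IHi].
  by rewrite expr0 mul1r mulr1.
by rewrite exprSr mulrA IHi -[LHS]mulrA -[RHS]mulrA zc.
Qed.

Lemma distinct_coset_representatives N H : is_subgroup H -> is_subgroup N ->
  finite_index_in N H -> exists k (r : 'I_k -> D), [/\ forall i, H (r i),
    forall y, H y -> exists i, N ((r i)^-1 * y) & forall i j, N ((r i)^-1 * r j) -> i = j].
Proof.
move=> Hg Ng [NH [l [lH lc]]]; have [_ Hu _ _] := Hg; have [_ Nu NM NV] := Ng.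
pose E k := exists r : 'I_k -> D, (forall i, H (r i)) /\
   forall y, H y -> exists i, N ((r i)^-1 * y).
have exE : exists k, `[< E k >].
  exists (size l); apply/asboolP; exists (fun i => l`_i); split=> [i|y Hy].
    by apply: lH; apply: mem_nth.
  have [z zl Nz] := lc _ Hy; have zs : (index z l < size l)%N by rewrite index_mem.
  by exists (Ordinal zs); rewrite /= nth_index.
case: (ex_minnP exE) => k /asboolP[r [rH rc]] kmin; exists k, r; split=> // i j Nij.
apply: contrapT => /eqP ij; case: k r rH rc kmin i j Nij ij => [|k] r rH rc kmin i j Nij ij.
  by case: i {Nij ij}.
suff /kmin : `[< E k >] by rewrite ltnn.
apply/asboolP; exists (fun l => r (lift j l)); split=> // y /rc[l' Nl].
have [l'j|jl'] := eqVneq j l'; last first.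
  by have [i' l'E _] := unlift_some jl'; exists i'; rewrite -l'E.
have ji : j != i by rewrite eq_sym.
have [i' iE _] := unlift_some ji; exists i'; rewrite -iE.
rewrite -l'j in Nl; have := NM _ _ Nij Nl; rewrite -mulrA mulVKr //; exact: Hu.
Qed.

Lemma finite_quotient_permutations N H : is_subgroup H -> is_subgroup N ->
  normal_in N H -> finite_index_in N H ->
  exists k (phi : D -> 'S_k), (forall x y, H x -> H y -> phi (x * y) = (phi x * phi y)%g) /\
    forall x y, H x -> H y -> phi x = phi y -> N (x * y^-1).
Proof.
move=> Hg Ng [_ Nn] fi; have [k [r [rH rc rinj]]] := distinct_coset_representatives Hg Ng fi.
have [H1 Hu HM HV] := Hg; have [_ Nu NM NV] := Ng.
have [i0 _] := rc _ H1.
have /choice[f fP] : forall y, exists i, H y -> N ((r i)^-1 * y).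
  by move=> y; have [/rc[i Ni]|nHy] := pselect (H y); [exists i | exists i0].
have coset_trans x y z : H x -> N (x^-1 * y) -> N (y^-1 * z) -> H y -> N (x^-1 * z).
  move=> Hx Nxy Nyz Hy; have := NM _ _ Nxy Nyz; rewrite -mulrA mulVKr //; exact: Hu.
have coset_sym x y : H x -> H y -> N (x^-1 * y) -> N (y^-1 * x).
  by move=> Hx Hy /NV; rewrite invrM ?unitrV ?Hu // invrK.
have f_unique y i : H y -> N ((r i)^-1 * y) -> f y = i.
  move=> Hy Ni; apply: rinj; apply: (coset_trans _ y) => //; first exact: fP.
  exact: coset_sym.
have HVM x y : H x -> H y -> H (x^-1 * y) by move=> Hx Hy; apply: HM => //; apply: HV.
have f_inj x : H x -> injective (fun i => f (x^-1 * r i)).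
  move=> Hx i j eij; apply: rinj.
  have Ni := fP _ (HVM _ _ Hx (rH i)); have Nj := fP _ (HVM _ _ Hx (rH j)); rewrite -eij in Nj.
  have := NM _ _ (NV _ Ni) Nj; rewrite !invrM ?unitrV ?invrK ?Hu //; last by apply: HVM.
  by rewrite -!mulrA mulVKr ?Hu // mulVKr ?Hu.
(* Acting by [x^-1] on left cosets makes [phi] a homomorphism, since permutations compose from left
   to right. *)
have /choice[phi phiP] : forall x, exists p : 'S_k, H x -> forall i, p i = f (x^-1 * r i).
  move=> x; have [Hx|nHx] := pselect (H x); last by exists 1%g.
  by exists (perm (f_inj x Hx)) => _ i; rewrite permE.
exists k, phi; split=> x y Hx Hy.
  apply/permP => i; rewrite permM !phiP //; last exact: HM.
  set l := f (x^-1 * r i); apply: f_unique; first by apply: HVM => //; apply: HM.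
  rewrite invrM ?Hu // -mulrA.
  apply: (coset_trans _ (y^-1 * r l)) => //; last exact: HVM; first exact: fP (HVM _ _ Hy (rH l)).
  rewrite invrM ?invrK ?unitrV ?Hu // -!mulrA mulVKr ?Hu //.
  exact: (fP _ (HVM _ _ Hx (rH i))).
move=> /permP/(_ i0); rewrite !phiP // => e.
have Nx := fP _ (HVM _ _ Hx (rH i0)); have Ny := fP _ (HVM _ _ Hy (rH i0)); rewrite -e in Ny.
have := NM _ _ (NV _ Nx) Ny; rewrite !invrM ?unitrV ?invrK ?Hu //; last by apply: HVM.
rewrite -!mulrA mulVKr ?Hu // => /Nn/(_ (HV _ (rH i0))); rewrite invrK -!mulrA mulVKr ?Hu //.
by rewrite mulrV ?mulr1 // Hu.
Qed.

(** Commutation of two elements of [H] depends only on their images in the finite quotient because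
    [N] is central; this defines [c], and the pair found in the quotient lifts. *)
Lemma central_finite_index_commuting_conjugates N H : is_subgroup H -> is_subgroup N ->
  normal_in N H -> finite_index_in N H -> (forall x y, N x -> H y -> x * y = y * x) ->
  ~ Defs.abelian H -> commuting_conjugates H.
Proof.
move=> Hg Ng Nn fi Nc nab; have [H1 Hu HM HV] := Hg.
have [k [phi [phiM phi_ker]]] := finite_quotient_permutations Hg Ng Nn fi.
have phi1 : phi 1 = 1%g.
  by apply: (mulgI (phi 1)); rewrite -phiM // mulr1 mulg1.
have phiV x : H x -> phi x^-1 = (phi x)^-1%g.
  move=> Hx; have Hx' := HV _ Hx; apply: (mulgI (phi x)).
  by rewrite -phiM // mulrV ?Hu // mulgV phi1.
have HJ x z : H x -> H z -> H (z^-1 * x * z).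
  by move=> Hx Hz; exact: HM _ _ (HM _ _ (HV _ Hz) Hx) Hz.
have phiJ x z : H x -> H z -> phi (z^-1 * x * z) = (phi x ^ phi z)%g.
  move=> Hx Hz; have Hz' := HV _ Hz.
  by rewrite phiM ?phiM ?phiV // ?conjgE ?mulgA //; exact: HM.
pose c (p1 p2 : 'S_k) := `[< forall x y, H x -> H y -> phi x = p1 -> phi y = p2 -> x * y = y * x >].
have cP x y : H x -> H y -> c (phi x) (phi y) <-> x * y = y * x.
  move=> Hx Hy; split=> [/asboolP|xy]; first by apply.
  apply/asboolP => x' y' Hx' Hy' /(phi_ker _ _ Hx' Hx) Nx /(phi_ker _ _ Hy' Hy) Ny.
  rewrite -[x'](mulrVK (Hu _ Hx)) -[y'](mulrVK (Hu _ Hy)).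
  move: (x' * x^-1) (y' * y^-1) Nx Ny => u v Nu Nv.
  have [_ NuH _ _] := Ng.
  have cu := Nc u; have cv := Nc v; have uv : u * v = v * u by apply: Nc => //; case: Nn => NH _; apply: NH.
  rewrite -!mulrA (mulrA x) -cv // (mulrA y) -cu // -!mulrA (mulrA u) uv -mulrA xy //.
pose G := [set p : 'S_k | `[< exists2 x, H x & phi x = p >]].
have GP p : p \in G <-> exists2 x, H x & phi x = p.
  by rewrite inE; split=> [/asboolP|?]; last apply/asboolP.
have G_group : group_set G.
  apply/group_setP; split; first by apply/GP; exists 1.
  move=> p1 p2 /GP[x Hx <-] /GP[y Hy <-]; apply/GP; exists (x * y); first exact: HM.
  exact: phiM.
have [||||||h Gh [p Gp [nph ph]]] := @commutation_self_conjugates _ c (Group G_group) _ _ _ _ _ (Group G_group) (subxx _).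
- by move=> _ /GP[x Hx <-]; apply/cP.
- by move=> _ /GP[x Hx <-]; rewrite -phi1; apply/cP => //; rewrite mulr1 mul1r.
- by move=> _ _ /GP[x Hx <-] /GP[y Hy <-] /cP-/(_ Hx Hy) e; apply/cP.
- move=> _ _ _ /GP[x Hx <-] /GP[y Hy <-] /GP[z Hz <-] /cP-/(_ Hx Hy) e /cP-/(_ Hx Hz) e'.
  by rewrite -phiM //; apply/cP => //; [exact: HM | rewrite mulrA e -mulrA e' mulrA].
- move=> _ _ _ /GP[x Hx <-] /GP[y Hy <-] /GP[z Hz <-] /cP-/(_ Hx Hy) e.
  rewrite -!phiJ //; apply/cP; [exact: HJ | exact: HJ |].
  by have := conj_iterM x y 1 (Hu _ Hz); rewrite e conj_iterM ?Hu // /conj_iter expr1.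
- apply: contrapT => no; apply: nab => x y Hx Hy; apply: contrapT => xy; apply: no.
  exists (phi x); first by apply/GP; exists x.
  by exists (phi y); [apply/GP; exists y | apply/negP => /cP-/(_ Hx Hy)].
move/GP: Gh => [y Hy yh]; move/GP: Gp => [x Hx xp]; subst h p.
exists y, x; split=> //; first by apply/eqP => e; case/negP: nph; apply/cP.
move=> i; have Hyi : H (y ^+ i) by apply: subgroupX.
have phiX : phi (y ^+ i) = (phi y ^+ i)%g.
  by elim: (i) => [|j IHj]; rewrite ?expr0 // exprS expgS phiM ?IHj //; apply: subgroupX.
have := ph i; rewrite -phiX -phiJ // => /cP; apply=> //; exact: HJ.
Qed.

Lemma nilpotent_by_finite_commuting_conjugates H : is_subgroup H ->
  nilpotent_by_finite H -> ~ Defs.abelian H -> commuting_conjugates H.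
Proof.
move=> Hg [N [Ng [Nn [Nnil fi]]]] nab; have [NH Nconj] := Nn; have [H1 Hu HM HV] := Hg.
have [Nab|Nnab] := pselect (Defs.abelian N); last first.
  have [h [a [Nh ah cc]]] := nilpotent_commuting_conjugates Ng Nnil Nnab.
  by exists h, a; split=> //; apply: NH.
have [Nc|Nnc] := pselect (forall x y, N x -> H y -> x * y = y * x).
  exact: central_finite_index_commuting_conjugates Nc nab.
(* With [a] in the abelian normal subgroup [N], all its conjugates stay in [N] and commute. *)
have [a [h [Na Hh ah]]] : exists x y, [/\ N x, H y & x * y <> y * x].
  apply: contrapT => nxy; apply: Nnc => x y Nx Hy; apply: contrapT => xy.
  by apply: nxy; exists x, y.
exists h, a; split=> //; first exact/eqP.
by move=> i; apply: Nab => //; apply: Nconj => //; apply: subgroupX.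
Qed.
End CommutingConjugates.

Theorem theorem4p7 (D : unitRingType) (G : D -> Prop) :
  is_division_ring D -> algebraic_over_center D ->
  is_subgroup G -> almost_subnormal (fun x : D => x \is a GRing.unit) G ->
  (exists H : D -> Prop, is_subgroup H /\ sub H G /\
     ~ abelian H /\ nilpotent_by_finite H) ->
  exists H : D -> Prop, is_subgroup H /\ sub H G /\ is_free H /\ ~ cyclic H.
Proof.
move=> divD algD Gg Gsn [H [Hg [HG [nab nbf]]]].
have [h [a [Hh ah cc]]] := nilpotent_by_finite_commuting_conjugates Hg nbf nab.
exact: (commuting_conjugates_free divD algD Gg Gsn (HG _ Hh) cc ah).
Qed.
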